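(* Let $\Lambda$ be an algebra, and let $n$ be $\infty$ or a non-negative integer. Then the following are equivalent: (1) $\operatorname{tilt}_n\Lambda$ has a minimal element. (2) $\operatorname{tilt}_n\Lambda$ has the minimum element. (3) There exists $T\in\operatorname{tilt}_n\Lambda$ such that ${}^{\bot}T\supseteq\mathcal{P}_n(\Lambda)$. (4) There exists $T\in\operatorname{tilt}_n\Lambda$ such that ${}^{\bot}(T^{\bot})=\mathcal{P}_n(\Lambda)$. (5) The subcategory $\mathcal{P}_n(\Lambda)$ of $\mathsf{mod}\,\Lambda$ is contravariantly finite.
   Context: $K$ is an algebraically closed field; all algebras are basic connected finite dimensional $K$-algebras, and all modules are finitely generated right modules. $\mathsf{mod}\,\Lambda$ is the category of finitely generated right $\Lambda$-modules; $\mathsf{add}\,T$ is the full subcategory of direct summands of finite direct sums of copies of $T$. A module $T\in\mathsf{mod}\,\Lambda$ is a tilting module if its projective dimension is some $d<\infty$, $\operatorname{Ext}^i_\Lambda(T,T)=0$ for all $i\ge1$, and there is an exact sequence $0\to\Lambda\to T_0\to\cdots\to T_d\to0$ with all $T_i\in\mathsf{add}\,T$. Modules $M,N$ are additively equivalent if $\mathsf{add}\,M=\mathsf{add}\,N$. For an integer $n\ge0$, $\operatorname{tilt}_n\Lambda$ is the set of additive equivalence classes of tilting modules of projective dimension at most $n$, and $\operatorname{tilt}_\infty\Lambda=\operatorname{tilt}\Lambda=\bigcup_{n\ge0}\operatorname{tilt}_n\Lambda$. These sets are partially ordered by: $T\ge U$ if $\operatorname{Ext}^i_\Lambda(T,U)=0$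 for all $i>0$. A module is identified with its additive equivalence class. For an integer $n\ge 0$, $\mathcal{P}_n(\Lambda)$ is the full subcategory of $\mathsf{mod}\,\Lambda$ of modules of projective dimension at most $n$, and $\mathcal{P}_\infty(\Lambda)$ that of modules of finite projective dimension. For a full subcategory $\mathcal{D}$ of $\mathsf{mod}\,\Lambda$, $\mathcal{D}^{\bot}$ is the full subcategory of modules $N$ with $\operatorname{Ext}^i_\Lambda(M,N)=0$ for all $i\ge1$ and $M\in\mathcal{D}$, and ${}^{\bot}\mathcal{D}$ is the full subcategory of modules $N$ with $\operatorname{Ext}^i_\Lambda(N,M)=0$ for all $i\ge1$ and $M\in\mathcal{D}$; for a module $T$, $T^{\bot}=(\mathsf{add}\,T)^{\bot}$ and ${}^{\bot}T={}^{\bot}(\mathsf{add}\,T)$. A full subcategory $\mathcal{C}$ of $\mathsf{mod}\,\Lambda$ is contravariantly finite if for every $M\in\mathsf{mod}\,\Lambda$ there is a morphism $C_M\to M$ with $C_M\in\mathcal{C}$ such that $\operatorname{Hom}_\Lambda(C,C_M)\to\operatorname{Hom}_\Lambda(C,M)$ is surjective for all $C\in\mathcal{C}$. *)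

(* Defs.v *)
From HB Require Import structures.
From mathcomp Require Import all_boot all_order all_algebra.
From mathcomp Require Import falgebra.

Set Implicit Arguments.
Unset Strict Implicit.
Unset Printing Implicit Defensive.

Import GRing.Theory.
Local Open Scope ring_scope.

(* An object of mod A.  As A is finite dimensional over K, a right A-module is
   finitely generated exactly when its underlying K-space is finite
   dimensional, which is what the vectType carrier provides. *)
Record rmod (K : fieldType) (A : falgType K) := RMod {
  rmod_car :> vectType K;
  ract : rmod_car -> A -> rmod_car;
  ractDl : forall x y a, ract (x + y) a = ract x a + ract y a;
  ractDr : forall x a b, ract x (a + b) = ract x a + ract x b;
  ractZl : forall k x a, ract (k *: x) a = k *: ract x a;
  ractZr : forall k x a, ract x (k *: a) = k *: ract x a;
  ract1 : forall x, ract x 1 = x;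
  ractM : forall x a b, ract x (a * b) = ract (ract x a) b
}.

Record rhom (K : fieldType) (A : falgType K) (M N : rmod A) := RHom {
  rhom_lin :> 'Hom(M, N);
  rhom_act : forall x a, rhom_lin (ract x a) = ract (rhom_lin x) a
}.

Section Modules.
Variables (K : fieldType) (A : falgType K).
Implicit Types (M N P T U X Y : rmod A) (D E : rmod A -> Prop).

Definition regular : rmod A :=
  @RMod K A A (fun x a => x * a)
    (fun x y a => mulrDl x y a) (fun x a b => mulrDr x a b)
    (fun k x a => esym (scalerAl k x a)) (fun k x a => esym (scalerAr k x a))
    (fun x => mulr1 x) (fun x a b => mulrA x a b).

Definition rzero : rmod A.
Proof.
by refine (@RMod K A 'rV[K]_0 (fun _ _ => 0) _ _ _ _ _ _) => *;
  rewrite ?addr0 ?scaler0 //; apply/rowP => - [].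
Defined.

Definition dsum M N : rmod A.
Proof.
refine (@RMod K A (M * N)%type (fun x a => (ract x.1 a, ract x.2 a)) _ _ _ _ _ _).
- by move=> x y a; congr pair; rewrite ractDl.
- by move=> x a b; congr pair; rewrite ractDr.
- by move=> k x a; congr pair; rewrite ractZl.
- by move=> k x a; congr pair; rewrite ractZr.
- by case=> x y /=; rewrite !ract1.
- by move=> x a b; congr pair; rewrite ractM.
Defined.

Definition is_zero M : Prop := forall x : M, x = 0.

Definition injm M N (f : rhom M N) : Prop := injective f.

Definition surjm M N (f : rhom M N) : Prop := forall y, exists x, f x = y.

Definition exact_at X Y M (f : rhom X Y) (g : rhom Y M) : Prop :=
  forall y, g y = 0 <-> exists x, f x = y.

Definition iso M N : Prop := exists f : rhom M N, bijective f.

Definition indecomposable M : Prop :=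
  ~ is_zero M /\
  forall X Y, iso M (dsum X Y) -> is_zero X \/ is_zero Y.

Definition in_add T M : Prop :=
  exists (m : nat) (N : rmod A), iso (dsum M N) (\big[dsum/rzero]_(i < m) T).

Definition add_equiv T U : Prop := forall M, in_add T M <-> in_add U M.

Definition projective P : Prop :=
  forall X Y (p : rhom X Y) (f : rhom P Y), surjm p ->
  exists g : rhom P X, forall x, p (g x) = f x.

Record projres M := ProjRes {
  pr_obj :> nat -> rmod A;
  pr_d : forall i, rhom (pr_obj i.+1) (pr_obj i);
  pr_aug : rhom (pr_obj 0%N) M;
  pr_proj : forall i, projective (pr_obj i);
  pr_aug_surj : surjm pr_aug;
  pr_exact0 : exact_at (pr_d 0%N) pr_aug;
  pr_exactS : forall i, exact_at (pr_d i.+1) (pr_d i)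
}.

(* For the zero module the least such n is 0, so that it lies in every P_n. *)
Definition pdim_le (n : nat) M : Prop :=
  exists R : projres M, forall i, (n < i)%N -> is_zero (R i).

Definition pdim_eq (n : nat) M : Prop :=
  pdim_le n M /\ forall m, (m < n)%N -> ~ pdim_le m M.

(* Ext^i(M, N) = 0: the i-th cohomology of Hom(R, N) vanishes, R being a
   projective resolution of M; it does not depend on the choice of R. *)
Definition ext_zero (i : nat) M N : Prop :=
  forall R : projres M,
  match i with
  | 0%N => forall f : rhom (R 0%N) N,
      (forall x, f (pr_d R 0%N x) = 0) -> forall x, f x = 0
  | j.+1 => forall f : rhom (R j.+1) N,
      (forall x, f (pr_d R j.+1 x) = 0) ->
      exists g : rhom (R j) N, forall x, f x = g (pr_d R j x)
  end.

Definition ext_pos_zero M N : Prop :=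
  forall i : nat, (0 < i)%N -> ext_zero i M N.

(* An exact sequence 0 -> A -> C 0 -> ... -> C d -> 0 with terms in add T,
   extended by zero modules in degrees greater than d. *)
Definition add_coresolution (d : nat) T : Prop :=
  exists (C : nat -> rmod A) (eta : rhom regular (C 0%N))
         (del : forall i, rhom (C i) (C i.+1)),
    [/\ forall i, (i <= d)%N -> in_add T (C i),
        forall i, (d < i)%N -> is_zero (C i),
        injm eta,
        exact_at eta (del 0%N)
      & forall i, exact_at (del i) (del i.+1)].

Definition tilting T : Prop :=
  exists d : nat, [/\ pdim_eq d T, ext_pos_zero T T & add_coresolution d T].

(* The index n ranges over the non-negative integers and infinity (None). *)
Definition Pn (n : option nat) M : Prop :=
  if n is Some m then pdim_le m M else exists m : nat, pdim_le m M.

(* tilt n and the relation tilt_ge are invariant under add_equiv; elements of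
   the poset of additive equivalence classes are given by representatives,
   equality of classes being add_equiv. *)
Definition tilt (n : option nat) T : Prop := tilting T /\ Pn n T.

Definition tilt_ge T U : Prop := ext_pos_zero T U.

Definition tilt_minimal (n : option nat) T : Prop :=
  tilt n T /\ forall U, tilt n U -> tilt_ge T U -> add_equiv U T.

Definition tilt_minimum (n : option nat) T : Prop :=
  tilt n T /\ forall U, tilt n U -> tilt_ge U T.

Definition rperp D N : Prop := forall M, D M -> ext_pos_zero M N.

Definition lperp D N : Prop := forall M, D M -> ext_pos_zero N M.

Definition contravariantly_finite D : Prop :=
  forall M, exists (C : rmod A) (p : rhom C M),
    D C /\
    forall X, D X -> forall f : rhom X M,
    exists g : rhom X C, forall x, p (g x) = f x.

End Modules.

Arguments regular {K} A.
Arguments rzero {K A}.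

(* The P i are the modules e_i A for a complete set of primitive orthogonal
   idempotents e_i; by Krull-Schmidt any such decomposition may be used. *)
Definition basic_alg (K : fieldType) (A : falgType K) : Prop :=
  exists (m : nat) (P : 'I_m -> rmod A),
    [/\ forall i, indecomposable (P i),
        forall i j, i != j -> ~ iso (P i) (P j)
      & iso (regular A) (\big[@dsum K A/rzero]_(i < m) P i)].

(* algType excludes the zero algebra. *)
Definition connected_alg (K : fieldType) (A : falgType K) : Prop :=
  forall (B C : algType K) (f : {lrmorphism A -> (B * C)%type}), ~ bijective f.

(* Main.v *)
Require Import Defs.
From HB Require Import structures.
From mathcomp Require Import all_boot all_order all_algebra.
From mathcomp Require Import falgebra.
From mathcomp Require Import zify.
From Stdlib Require Import Classical ClassicalEpsilon.

Set Implicit Arguments.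
Unset Strict Implicit.
Unset Printing Implicit Defensive.

Import GRing.Theory.
Local Open Scope ring_scope.

(* The key construction lowers a tilting module T in P_n when some X in P_n has
   Ext^i(X, T) <> 0. Replacing X by its T^perp-envelope and following an add
   T-resolution gives a nonsplit exact sequence 0 -> T1 -> T0 -> Y -> 0 with
   T1, T0 in add T and Y in P_n. By Krull-Schmidt arguments, T then embeds with
   cokernel in P_n into a module B in add T' for some T' in add T with T not in
   add T'. If T -> B is a left add T'-approximation with cokernel C, then
   T' (+) C is a tilting module in P_n, it is below T, and Ext^1(C, T) <> 0.
   So a minimal or minimum T satisfies (3). Given (3), every N in T^perp has an
   add T-resolution with kernels in T^perp, and shifting dimensions along it
   yields (4); special approximations by the cotorsion pair of T give (5). If
   P_n is contravariantly finite, minimal approximations have kernels in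
   P_n^perp (Wakamatsu); hence P_n has bounded projective dimension even for
   n = oo, and coresolving A by modules in P_n and P_n^perp produces a tilting
   module T with Ext^i(P_n, T) = 0, which is minimal. *)

(** * Modules and exact sequences *)

(** An arbitrary summand of [T] cannot simply be exchanged: a left approximation of [T] by a smaller
    add T' must be a monomorphism with cokernel in P_n, and the nonsplit embedding T1 -> T0 is
    sought in order to force this. That embedding may still map T1 into copies of T1. For T1
    indecomposable the endomorphisms arising this way are nilpotent, and substituting the embedding
    into itself pushes them down a Loewy filtration until none is left. Minimal choices are made by
    K-dimension. That the new module is tilting is checked in a form without a coresolution of A:
    generation of the perpendicular class. It passes from T to T' (+) C because maps T -> N extend
    along T -> B as soon as Ext^1(C, N) = 0. Ext is computed from the functorial embeddings N ->
    Hom_K(A, N), so dimension shifting needs neither chosen resolutions nor connecting maps; the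
    comparison with projective resolutions is made once. For n = oo the bound comes from the closure
    of well approximated modules under extensions: one bound for all quotients of A serves every
    module. *)

Section Morphisms.
Variables (K : fieldType) (A : falgType K).
Implicit Types (M N P X Y Z : rmod A).

Lemma ract0l M a : ract (0 : M) a = 0.
Proof. by have := ractZl 0 (0 : M) a; rewrite !scale0r. Qed.

Section Make.
Variables (M N : rmod A) (f : M -> N).
Hypotheses (fl : linear f) (fa : forall x a, f (ract x a) = ract (f x) a).

#[local] HB.instance Definition _ := GRing.isLinear.Build K M N *:%R f fl.

Lemma mkhom_act x a : linfun f (ract x a) = ract (linfun f x) a.
Proof. by rewrite !lfunE /= fa. Qed.

Definition mkhom : rhom M N := RHom mkhom_act.

Lemma mkhomE x : mkhom x = f x.
Proof. by rewrite /= lfunE. Qed.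

End Make.

Lemma rid_act M x a : (\1%VF : 'Hom(M, M)) (ract x a) = ract ((\1%VF : 'Hom(M, M)) x) a.
Proof. by rewrite !id_lfunE. Qed.
Definition rid M : rhom M M := RHom (@rid_act M).

Lemma rcomp_act M N P (g : rhom N P) (f : rhom M N) x a :
  (g \o f)%VF (ract x a) = ract ((g \o f)%VF x) a.
Proof. by rewrite !comp_lfunE !rhom_act. Qed.
Definition rcomp M N P (g : rhom N P) (f : rhom M N) : rhom M P :=
  RHom (rcomp_act g f).

Lemma rhom0_act M N x a : (0 : 'Hom(M, N)) (ract x a) = ract ((0 : 'Hom(M, N)) x) a.
Proof. by rewrite !zero_lfunE ract0l. Qed.
Definition rhom0 M N : rhom M N := RHom (@rhom0_act M N).

Lemma radd_act M N (f g : rhom M N) x a :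
  (rhom_lin f + rhom_lin g) (ract x a) = ract ((rhom_lin f + rhom_lin g) x) a.
Proof. by rewrite !add_lfunE !rhom_act ractDl. Qed.
Definition radd M N (f g : rhom M N) : rhom M N := RHom (radd_act f g).

Lemma rscale_act M N k (f : rhom M N) x a :
  (k *: rhom_lin f) (ract x a) = ract ((k *: rhom_lin f) x) a.
Proof. by rewrite !scale_lfunE !rhom_act ractZl. Qed.
Definition rscale M N k (f : rhom M N) : rhom M N := RHom (rscale_act k f).

Definition rsub M N (f g : rhom M N) : rhom M N := radd f (rscale (-1) g).

Lemma ridE M x : rid M x = x. Proof. exact: id_lfunE. Qed.
Lemma rcompE M N P (g : rhom N P) (f : rhom M N) x : rcomp g f x = g (f x).
Proof. exact: comp_lfunE. Qed.
Lemma rhom0E M N x : rhom0 M N x = 0. Proof. exact: zero_lfunE. Qed.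
Lemma raddE M N (f g : rhom M N) x : radd f g x = f x + g x.
Proof. exact: add_lfunE. Qed.
Lemma rscaleE M N k (f : rhom M N) x : rscale k f x = k *: f x.
Proof. exact: scale_lfunE. Qed.
Lemma rsubE M N (f g : rhom M N) x : rsub f g x = f x - g x.
Proof. by rewrite raddE rscaleE scaleN1r. Qed.

Lemma homD M N (f : rhom M N) x y : f (x + y) = f x + f y.
Proof. exact: linearD. Qed.
Lemma homB M N (f : rhom M N) x y : f (x - y) = f x - f y.
Proof. exact: linearB. Qed.
Lemma homN M N (f : rhom M N) x : f (- x) = - f x.
Proof. exact: linearN. Qed.
Lemma homZ M N (f : rhom M N) k x : f (k *: x) = k *: f x.
Proof. exact: linearZ. Qed.
Lemma hom0 M N (f : rhom M N) : f 0 = 0.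
Proof. exact: linear0. Qed.

Definition rhE := (ridE, rcompE, rhom0E, rsubE, raddE, rscaleE).

Definition rinl M N : rhom M (dsum M N).
Proof.
apply: (@mkhom M (dsum M N) (fun x => (x, 0))) => [k x y | x a].
  by congr pair; rewrite /= scaler0 addr0.
by congr pair; rewrite /= ract0l.
Defined.

Definition rinr M N : rhom N (dsum M N).
Proof.
apply: (@mkhom N (dsum M N) (fun y => (0, y))) => [k x y | x a].
  by congr pair; rewrite /= scaler0 addr0.
by congr pair; rewrite /= ract0l.
Defined.

Definition rfst M N : rhom (dsum M N) M.
Proof. by apply: (@mkhom (dsum M N) M (fun u => u.1)). Defined.

Definition rsnd M N : rhom (dsum M N) N.
Proof. by apply: (@mkhom (dsum M N) N (fun u => u.2)). Defined.

Lemma rinlE M N x : rinl M N x = (x, 0). Proof. exact: mkhomE. Qed.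
Lemma rinrE M N y : rinr M N y = (0, y). Proof. exact: mkhomE. Qed.
Lemma rfstE M N u : rfst M N u = u.1. Proof. exact: mkhomE. Qed.
Lemma rsndE M N u : rsnd M N u = u.2. Proof. exact: mkhomE. Qed.

Definition rpair X M N (f : rhom X M) (g : rhom X N) : rhom X (dsum M N) :=
  radd (rcomp (rinl M N) f) (rcomp (rinr M N) g).
Definition rcopair X M N (f : rhom M X) (g : rhom N X) : rhom (dsum M N) X :=
  radd (rcomp f (rfst M N)) (rcomp g (rsnd M N)).

Lemma rpairE X M N (f : rhom X M) (g : rhom X N) x : rpair f g x = (f x, g x).
Proof. by rewrite !rhE rinlE rinrE; congr pair; rewrite /= ?addr0 ?add0r. Qed.

Lemma rcopairE X M N (f : rhom M X) (g : rhom N X) u :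
  rcopair f g u = f u.1 + g u.2.
Proof. by rewrite !rhE rfstE rsndE. Qed.

Definition dsE := (rinlE, rinrE, rfstE, rsndE, rpairE, rcopairE, rhE).

End Morphisms.

#[global] Opaque mkhom rid rcomp rhom0 radd rscale rsub rinl rinr rfst rsnd rpair rcopair.

Section Exactness.
Variables (K : fieldType) (A : falgType K).
Implicit Types (M N P X Y Z : rmod A).

Definition ses X Y Z (i : rhom X Y) (p : rhom Y Z) : Prop :=
  [/\ injm i, surjm p & exact_at i p].

Lemma ses0 X Y Z (i : rhom X Y) (p : rhom Y Z) x : ses i p -> p (i x) = 0.
Proof. by case=> _ _ e; apply/e; exists x. Qed.

Lemma injmP X Y (i : rhom X Y) : (forall x, i x = 0 -> x = 0) -> injm i.
Proof.
by move=> h x y e; apply/subr0_eq/h; rewrite linearB /= e subrr.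
Qed.

Lemma injm0 X Y (i : rhom X Y) x : injm i -> i x = 0 -> x = 0.
Proof. by move=> h e; apply: h; rewrite e linear0. Qed.

Lemma fullvP (V W : vectType K) (f : 'Hom(V, W)) :
  (forall y, exists x, f x = y) -> forall y, y \in limg f.
Proof. by move=> s y; have [x <-] := s y; apply/memv_img/memvf. Qed.

Lemma lift_mono X Y Z (i : rhom Y Z) (f : rhom X Z) :
    injm i -> (forall x, exists y, i y = f x) ->
  exists g : rhom X Y, forall x, i (g x) = f x.
Proof.
move=> ii fi; pose h := (i^-1 \o f)%VF.
have hE x : i (h x) = f x.
  rewrite comp_lfunE limg_lfunVK //; have [y <-] := fi x; exact/memv_img/memvf.
have ha x a : h (ract x a) = ract (h x) a by apply: ii; rewrite rhom_act !hE rhom_act.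
by exists (RHom ha).
Qed.

(** The section [p^-1] is only K-linear. The composite with [f] does not depend on the section, as
    [f] kills the kernel of [p], and is therefore A-linear. *)
Lemma desc_epi X Y Z (p : rhom X Y) (f : rhom X Z) :
    surjm p -> (forall x, p x = 0 -> f x = 0) ->
  exists g : rhom Y Z, forall x, g (p x) = f x.
Proof.
move=> sp fp; pose h := (f \o p^-1)%VF.
have pK y : p (p^-1%VF y) = y by apply/limg_lfunVK/fullvP.
have hE x : h (p x) = f x.
  rewrite comp_lfunE; apply/subr0_eq; rewrite -linearB; apply: fp.
  by rewrite linearB /= pK subrr.
have ha y a : h (ract y a) = ract (h y) a.
  by have [x <-] := sp y; rewrite -rhom_act !hE rhom_act.
by exists (RHom ha).
Qed.

Lemma inv_hom X Y (f : rhom X Y) : injm f -> surjm f ->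
  exists g : rhom Y X, (forall x, g (f x) = x) /\ (forall y, f (g y) = y).
Proof.
move=> fi fs; have [|g gE] := lift_mono (f := rid Y) fi.
  by move=> y; have [x <-] := fs y; exists x; rewrite ridE.
exists g; split=> [x|y]; last by rewrite gE ridE.
by apply: fi; rewrite gE ridE.
Qed.

Lemma bij_hom X Y (f : rhom X Y) : injm f -> surjm f -> bijective f.
Proof. by move=> fi fs; have [g [gf fg]] := inv_hom fi fs; exists g. Qed.

Section Submodule.
Variables (M : rmod A) (U : {vspace M}).
Hypothesis Ua : forall x a, x \in U -> ract x a \in U.

Let sact (x : subvs_of U) a : subvs_of U := Subvs (Ua a (subvsP x)).

Definition submod : rmod A.
Proof.
refine (@RMod K A (subvs_of U) sact _ _ _ _ _ _) => *; apply: subvs_inj => /=.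
- exact: ractDl.
- exact: ractDr.
- exact: ractZl.
- exact: ractZr.
- exact: ract1.
- exact: ractM.
Defined.

Definition subincl : rhom submod M.
Proof. by apply: (@mkhom K A submod M (@vsval _ _ U)). Defined.

Lemma subincl_inj : injm subincl.
Proof. by move=> x y; rewrite !mkhomE => /subvs_inj. Qed.

Lemma subinclP y : (exists x, subincl x = y) <-> y \in U.
Proof.
split=> [[x <-]|Uy]; first by rewrite mkhomE; apply: subvsP.
by exists (Subvs Uy : submod); rewrite mkhomE.
Qed.

Lemma quot_ker (x : M) : x - projv U x = 0 <-> x \in U.
Proof.
split=> [/subr0_eq -> | Ux]; first exact: memv_proj.
by rewrite projv_id ?subrr.
Qed.

(** The quotient by [U] is realised on the complement [U^C]: [qpr] projects along [U], and the
    action is that of [M] followed by [qpr]. *)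
Let qpr (x : M) : subvs_of (U^C)%VS := Subvs (memv_projC U x).

Let qpr_lin : linear qpr.
Proof.
move=> k x y; apply: subvs_inj => /=.
by rewrite linearP /= scalerBr opprD addrACA.
Qed.

Let qpr_ker x : qpr x = 0 <-> x \in U.
Proof.
rewrite -quot_ker; split=> [/(congr1 (@vsval _ _ _))//|e].
exact: subvs_inj.
Qed.

Let qprK (y : subvs_of (U^C)%VS) : qpr (vsval y) = y.
Proof.
apply: subvs_inj => /=; rewrite [projv U _](_ : _ = 0) ?subr0 //.
by apply/eqP; rewrite -memv_ker lker_proj subvsP.
Qed.

Let qprD x y : qpr (x + y) = qpr x + qpr y.
Proof. by rewrite -[x]scale1r qpr_lin !scale1r. Qed.

Let qprZ k x : qpr (k *: x) = k *: qpr x.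
Proof.
have q0 : qpr 0 = 0 by apply/qpr_ker/mem0v.
by rewrite -[k *: x]addr0 qpr_lin q0 addr0.
Qed.

Let qact (y : subvs_of (U^C)%VS) a := qpr (ract (vsval y) a).

Let qpr_act x a : qpr (ract x a) = qact (qpr x) a.
Proof.
apply/subr0_eq; rewrite /qact.
have -> : ract x a = 1 *: ract (projv U x) a + ract (vsval (qpr x)) a.
  by rewrite scale1r -ractDl /= addrC subrK.
rewrite qpr_lin scale1r addrK; apply/qpr_ker/Ua/memv_proj.
Qed.

Definition quotmod : rmod A.
Proof.
refine (@RMod K A (subvs_of (U^C)%VS) qact _ _ _ _ _ _).
- by move=> x y a; rewrite /qact -qprD -ractDl.
- by move=> x a b; rewrite /qact ractDr qprD.
- by move=> k x a; rewrite /qact -qprZ -ractZl.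
- by move=> k x a; rewrite /qact -qprZ -ractZr.
- by move=> x; rewrite /qact ract1 qprK.
- by move=> x a b; rewrite {1}/qact ractM qpr_act.
Defined.

Definition quotproj : rhom M quotmod.
Proof. exact: (@mkhom K A M quotmod qpr qpr_lin qpr_act). Defined.

Lemma quotproj_surj : surjm quotproj.
Proof. by move=> y; exists (vsval y); rewrite mkhomE; apply: qprK. Qed.

Lemma quotprojP x : quotproj x = 0 <-> x \in U.
Proof. by rewrite mkhomE; apply: qpr_ker. Qed.

End Submodule.
End Exactness.

(** * Kernels, pullbacks, pushouts and the exact sequences they produce *)

Section Diagrams.
Variables (K : fieldType) (A : falgType K).
Implicit Types (M N P X Y Z : rmod A).

Lemma kernel_ex X Y (f : rhom X Y) :
  exists (Z : rmod A) (i : rhom Z X), injm i /\ exact_at i f.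
Proof.
have Ua x a : x \in lker f -> ract x a \in lker f.
  by rewrite !memv_ker rhom_act => /eqP ->; rewrite ract0l.
exists (submod Ua), (subincl Ua); split; first exact: subincl_inj.
move=> y; rewrite subinclP memv_ker; split=> [->|/eqP//].
exact: eqxx.
Qed.

Lemma cokernel_ex X Y (f : rhom X Y) :
  exists (Z : rmod A) (p : rhom Y Z), surjm p /\ exact_at f p.
Proof.
have Ua y a : y \in limg f -> ract y a \in limg f.
  by move=> /memv_imgP [x _ ->]; rewrite -rhom_act memv_img ?memvf.
exists (quotmod Ua), (quotproj Ua); split; first exact: quotproj_surj.
move=> y; rewrite quotprojP; split=> [/memv_imgP [x _ ->]|[x <-]]; first by exists x.
exact/memv_img/memvf.
Qed.

Lemma ses_epi X Y (p : rhom X Y) : surjm p ->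
  exists (Z : rmod A) (i : rhom Z X), ses i p.
Proof. by move=> sp; have [Z [i [ii e]]] := kernel_ex p; exists Z, i. Qed.

Lemma ses_mono X Y (i : rhom X Y) : injm i ->
  exists (Z : rmod A) (p : rhom Y Z), ses i p.
Proof. by move=> ii; have [Z [p [sp e]]] := cokernel_ex i; exists Z, p. Qed.

Lemma image_fact X Y (f : rhom X Y) :
  exists (V : rmod A) (p : rhom X V) (i : rhom V Y),
    [/\ surjm p, injm i & forall x, i (p x) = f x].
Proof.
have [Z [q [_ eq]]] := cokernel_ex f.
have [V [i [ii ei]]] := kernel_ex q.
have [x|p pE] := lift_mono (f := f) ii; first by apply/ei/eq; exists x.
exists V, p, i; split=> // v; have /ei/eq [x fx] : exists v', i v' = i v by exists v.
by exists x; apply: ii; rewrite pE.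
Qed.

Lemma pullback_ex X Y Z (f : rhom X Z) (g : rhom Y Z) :
  exists (E : rmod A) (u : rhom E X) (v : rhom E Y),
    [/\ forall e, f (u e) = g (v e),
        forall x y, f x = g y -> exists e, u e = x /\ v e = y
      & forall e, u e = 0 -> v e = 0 -> e = 0].
Proof.
have [E [i [ii ei]]] := kernel_ex (rcopair f (rscale (-1) g)).
exists E, (rcomp (rfst _ _) i), (rcomp (rsnd _ _) i); split=> [e|x y fg|e].
- rewrite !dsE; apply/subr0_eq.
  have : rcopair f (rscale (-1) g) (i e) = 0 by apply/ei; exists e.
  by rewrite !dsE scaleN1r.
- have [|e ie] := (ei (x, y)).1 _; first by rewrite !dsE /= scaleN1r fg subrr.
  by exists e; rewrite !dsE ie.
rewrite !dsE => e1 e2; apply: (injm0 ii).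
by rewrite [i e]surjective_pairing e1 e2.
Qed.

Lemma pushout_ex X Y Z (f : rhom Z X) (g : rhom Z Y) :
  exists (E : rmod A) (u : rhom X E) (v : rhom Y E),
    [/\ forall z, u (f z) = v (g z),
        forall e, exists x y, e = u x + v y
      & forall x y, u x = v y -> exists z, f z = x /\ g z = y].
Proof.
have [E [p [sp ep]]] := cokernel_ex (rpair f (rscale (-1) g)).
exists E, (rcomp p (rinl _ _)), (rcomp p (rinr _ _)); split=> [z|e|x y].
- rewrite !dsE; apply/subr0_eq; rewrite -homB; apply/ep; exists z.
  by rewrite !dsE; congr pair; rewrite /= ?subr0 ?sub0r ?scaleN1r.
- have [[x y] <-] := sp e; exists x, y; rewrite !dsE -homD.
  by congr (p _); congr pair; rewrite /= ?addr0 ?add0r.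
rewrite !dsE => /eqP; rewrite -subr_eq0 -linearB => /eqP /ep [z].
rewrite !dsE => -[e1 e2]; exists z; split; first by rewrite e1 subr0.
by move: e2; rewrite scaleN1r sub0r => /oppr_inj.
Qed.

Lemma ses_pull X Y Z Z' (i : rhom X Y) (p : rhom Y Z) (f : rhom Z' Z) :
    ses i p ->
  exists (Y' : rmod A) (i' : rhom X Y') (p' : rhom Y' Z') (g : rhom Y' Y),
    [/\ ses i' p', forall x, g (i' x) = i x, forall y, p (g y) = f (p' y)
      & forall y z, p y = f z -> exists y', g y' = y /\ p' y' = z].
Proof.
move=> s; have [ii sp ep] := s.
have [E [u [v [uv cE iE]]]] := pullback_ex p f.
have iuv : injm (rpair u v).
  by apply: injmP => e; rewrite dsE => -[]; apply: iE.
have [x|j jE] := lift_mono (f := rpair i (rhom0 X Z')) iuv.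
  have [|e [e1 e2]] := cE (i x) 0; first by rewrite (ses0 _ s) linear0.
  by exists e; rewrite !dsE e1 e2.
have uj x : u (j x) = i x by have := jE x; rewrite !dsE => -[].
have vj x : v (j x) = 0 by have := jE x; rewrite !dsE => -[].
exists E, j, v, u; split=> //; split=> [|z|e].
- by apply: injmP => x jx; apply: (injm0 ii); rewrite -uj jx linear0.
- by have [y py] := sp (f z); have [e [_ ve]] := cE _ _ py; exists e.
split=> [ve|[x <-]]; last by rewrite vj.
have /ep [x ix] : p (u e) = 0 by rewrite uv ve linear0.
by exists x; apply: iuv; rewrite !dsE uj vj ix ve.
Qed.

(** Pulling back one epimorphism along another puts the same middle module into two exact sequences.
    With [Sigma_ses] as one of the two, this turns an approximation of a cosyzygy into an embedding
    of the module itself. *)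
Lemma ses_pull2 X Y Z W Z' (i : rhom X Y) (p : rhom Y Z)
    (k : rhom W Z') (q : rhom Z' Z) :
    ses i p -> ses k q ->
  exists (Y' : rmod A) (i' : rhom X Y') (p' : rhom Y' Z')
         (k' : rhom W Y') (q' : rhom Y' Y),
    [/\ ses i' p', ses k' q', forall x, q' (i' x) = i x,
        forall w, p' (k' w) = k w & forall y, p (q' y) = q (p' y)].
Proof.
move=> s t; have [ik sq eq] := t; have [ii sp ep] := s.
have [Y' [i' [p' [q' [s' q'i' pq' ex]]]]] := ses_pull q s.
have ij y : q' y = 0 -> p' y = 0 -> y = 0.
  case: (s') => ii' _ ep' e1 e2; have [x e3] := (ep' y).1 e2.
  by move: e1; rewrite -e3 q'i' => /(injm0 ii) ->; rewrite linear0.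
have iqp : injm (rpair q' p') by apply: injmP => y; rewrite dsE => -[]; apply: ij.
have [w|k' k'E] := lift_mono (f := rpair (rhom0 W Y) k) iqp.
  have [|e [e1 e2]] := ex 0 (k w); first by rewrite (ses0 _ t) linear0.
  by exists e; rewrite !dsE e1 e2.
have qk w : q' (k' w) = 0 by have := k'E w; rewrite !dsE => -[].
have pk w : p' (k' w) = k w by have := k'E w; rewrite !dsE => -[].
exists Y', i', p', k', q'; split=> //; split=> [|y|y].
- by apply: injmP => w e; apply: (injm0 ik); rewrite -pk e linear0.
- by have [z qz] := sq (p y); have [e [qe _]] := ex _ _ (esym qz); exists e.
split=> [e|[w <-] //]; have /eq [w kw] : q (p' y) = 0 by rewrite -pq' e linear0.
by exists w; apply: iqp; rewrite !dsE qk pk e kw.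
Qed.

Lemma ses_push X Y Z X' (i : rhom X Y) (p : rhom Y Z) (f : rhom X X') :
    ses i p ->
  exists (Y' : rmod A) (i' : rhom X' Y') (p' : rhom Y' Z) (g : rhom Y Y'),
    [/\ ses i' p', forall x, i' (f x) = g (i x), forall y, p' (g y) = p y
      & forall y, exists x z, y = i' x + g z].
Proof.
move=> s; have [ii sp ep] := s.
have [E [u [v [uv cE iE]]]] := pushout_ex f i.
have suv : surjm (rcopair u v).
  by move=> e; have [x [y ->]] := cE e; exists (x, y); rewrite !dsE.
have [|q qE] := desc_epi (f := rcopair (rhom0 X' Z) p) suv.
  move=> [x y]; rewrite !dsE /= add0r => e.
  have [|z [_ e2]] := iE (- x) y.
    by apply/eqP; rewrite homN eq_sym -addr_eq0 addrC e.
  by rewrite -e2 (ses0 _ s).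
have qu x : q (u x) = 0 by have := qE (x, 0); rewrite !dsE /= !linear0 !addr0.
have qv y : q (v y) = p y by have := qE (0, y); rewrite !dsE /= !linear0 !add0r.
exists E, u, q, v; split=> //; split=> [|z|e].
- apply: injmP => x e; have [|z [<- e2]] := iE x 0; first by rewrite linear0.
  by rewrite (injm0 ii e2) linear0.
- by have [y <-] := sp z; exists (v y).
split=> [e0|[x <-] //]; have [x [y ee]] := cE e.
move: e0; rewrite ee homD qu qv add0r => /ep [z iz].
by exists (x + f z); rewrite homD uv iz.
Qed.

Lemma ses_noether X Y Z W V (i : rhom X Y) (p : rhom Y Z)
    (j : rhom W Z) (q : rhom Z V) :
    ses i p -> ses j q ->
  exists (G : rmod A) (i' : rhom X G) (p' : rhom G W) (g : rhom G Y),
    [/\ ses i' p', ses g (rcomp q p), forall x, g (i' x) = i x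
      & forall y, p (g y) = j (p' y)].
Proof.
move=> s t; have [ij sq eq] := t; have [ii sp ep] := s.
have [G [i' [p' [g [s' gi pg ex]]]]] := ses_pull j s.
exists G, i', p', g; split=> //; split=> [|z|y].
- have [_ _ ep'] := s'; apply: injmP => y e.
  have /ep' [x xy] : p' y = 0 by apply: (injm0 ij); rewrite -pg e linear0.
  by move: e; rewrite -xy gi => /(injm0 ii) ->; rewrite linear0.
- by have [w <-] := sq z; have [y <-] := sp w; exists y; rewrite rcompE.
rewrite rcompE; split=> [/eq [w jw]|[y' <-]]; last by rewrite pg (ses0 _ t).
by have [y' [<- _]] := ex y w (esym jw); exists y'.
Qed.

(** The cokernel of a composite of monomorphisms is an extension of the two cokernels; dual to
    [ses_noether]. *)
Lemma ses_noether' X Y Z W V (i : rhom X Y) (p : rhom Y Z)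
    (j : rhom Y W) (q : rhom W V) :
    ses i p -> ses j q ->
  exists (C : rmod A) (c : rhom W C) (a : rhom Z C) (b : rhom C V),
    ses (rcomp j i) c /\ ses a b.
Proof.
move=> s t; have [ij sq eq] := t; have [ii sp ep] := s.
have [C [a [b [c [s' ap bc ex]]]]] := ses_push p t.
exists C, c, a, b; split=> //; split=> [|e|w].
- by apply: injmP => x; rewrite rcompE => /(injm0 ij)/(injm0 ii).
- have [z [w ->]] := ex e; have [y <-] := sp z.
  by exists (j y + w); rewrite homD ap.
split=> [e|[x <-]]; last by rewrite rcompE -ap (ses0 _ s) linear0.
have /eq [y jy] : q w = 0 by rewrite -bc e linear0.
have [ia _ _] := s'; move: e; rewrite -jy -ap => /(injm0 ia)/ep [x ix].
by exists x; rewrite rcompE ix.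
Qed.

Lemma ses_dsum X Y Z X' Y' Z' (i : rhom X Y) (p : rhom Y Z)
    (i' : rhom X' Y') (p' : rhom Y' Z') :
    ses i p -> ses i' p' ->
  ses (rpair (rcomp i (rfst X X')) (rcomp i' (rsnd X X')))
      (rpair (rcomp p (rfst Y Y')) (rcomp p' (rsnd Y Y'))).
Proof.
move=> s t; have [ii sp ep] := s; have [ij sq eq] := t; split=> [|[z z']|[y y']].
- apply: injmP => -[x x']; rewrite !dsE /= => -[/(injm0 ii) -> /(injm0 ij) ->] //.
- by have [y <-] := sp z; have [y' <-] := sq z'; exists (y, y'); rewrite !dsE.
rewrite !dsE; split=> [[/ep [x <-] /eq [x' <-]]|[[x x']]].
  by exists (x, x'); rewrite !dsE.
by rewrite !dsE /= => -[<- <-]; rewrite (ses0 _ s) (ses0 _ t).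
Qed.

Lemma ses_split_sum X Y : ses (rinl X Y) (rsnd X Y).
Proof.
split=> [x x'|y|[x y]]; rewrite ?dsE; first by case.
  by exists (0, y); rewrite dsE.
split=> /= [->|[x']]; first by exists x; rewrite dsE.
by rewrite dsE => -[].
Qed.

Lemma ses_retr_sect X Y Z (i : rhom X Y) (p : rhom Y Z) (r : rhom Y X) :
    ses i p -> (forall x, r (i x) = x) ->
  exists s : rhom Z Y, (forall z, p (s z) = z) /\
    (forall y, s (p y) = y - i (r y)).
Proof.
move=> s ri; have [ii sp ep] := s.
have [|g gE] := desc_epi (f := rsub (rid Y) (rcomp i r)) sp.
  by move=> y /ep [x <-]; rewrite !rhE ri subrr.
exists g; split=> y; last by rewrite gE !rhE.
have [x <-] := sp y.
by rewrite gE !rhE homB (ses0 _ s) subr0.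
Qed.

Lemma ses_sect_retr X Y Z (i : rhom X Y) (p : rhom Y Z) (s : rhom Z Y) :
    ses i p -> (forall z, p (s z) = z) ->
  exists r : rhom Y X, (forall x, r (i x) = x) /\
    (forall y, i (r y) = y - s (p y)).
Proof.
move=> t ps; have [ii sp ep] := t.
have [y|g gE] := lift_mono (f := rsub (rid Y) (rcomp s p)) ii.
  by apply/ep; rewrite !rhE homB ps subrr.
exists g; split=> y; last by rewrite gE !rhE.
by apply: ii; rewrite gE !rhE (ses0 _ t) linear0 subr0.
Qed.

Lemma ses_id X Y (f : rhom X Y) Z : injm f -> surjm f -> is_zero Z ->
  ses f (rhom0 Y Z).
Proof.
move=> fi fs Z0; split=> [//|z|y]; first by exists 0; rewrite linear0 [z]Z0.
by rewrite rhE; split=> // _; have [x <-] := fs y; exists x.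
Qed.

Lemma rzero_is_zero : is_zero (@rzero K A).
Proof. by move=> x; apply/rowP => -[]. Qed.

End Diagrams.

(** * Ext by injective cosyzygies *)

Section LinfunOf.
Variables (K : fieldType) (V W : vectType K) (f : V -> W).
Hypothesis fl : linear f.

#[local] HB.instance Definition _ := GRing.isLinear.Build K V W *:%R f fl.

Lemma linear_lfunE x : linfun f x = f x.
Proof. by rewrite lfunE. Qed.

End LinfunOf.

Section Coinduced.
Variables (K : fieldType) (A : falgType K).
Implicit Types (M N P X Y Z : rmod A).

Let cact N (phi : 'Hom(A, N)) (a : A) : 'Hom(A, N) := linfun (fun b => phi (a * b)).

Let cactE N (phi : 'Hom(A, N)) a b : cact phi a b = phi (a * b).
Proof.
apply: linear_lfunE => k x y.
by rewrite mulrDr -scalerAr linearP.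
Qed.

(** The coinduced module Hom_K(A, N), right adjoint to the passage to K-spaces. Preferred to
    injective envelopes because it is an exact functor of [N], so that [Sigma] preserves exact
    sequences. *)
Definition coind N : rmod A.
Proof.
refine (@RMod K A 'Hom(A, N) (@cact N) _ _ _ _ _ _) => *; apply/lfunP => b;
  rewrite ?(cactE, add_lfunE, scale_lfunE) //.
- by rewrite mulrDl linearD.
- by rewrite -scalerAl linearZ.
- by rewrite mul1r.
- by rewrite mulrA.
Defined.

Lemma coind_actE N (phi : coind N) a b : (ract phi a : 'Hom(A, N)) b = (phi : 'Hom(A, N)) (a * b).
Proof. exact: cactE. Qed.

Lemma coind_adj M N (g : 'Hom(M, N)) :
  exists h : rhom M (coind N), forall x b, (h x : 'Hom(A, N)) b = g (ract x b).
Proof.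
pose F (x : M) : coind N := linfun (fun b => g (ract x b)).
have FE x b : (F x : 'Hom(A, N)) b = g (ract x b).
  by apply: linear_lfunE => k a a'; rewrite ractDr ractZr linearP.
have Fl : linear F.
  by move=> k x y; apply/lfunP => b; rewrite add_lfunE scale_lfunE !FE ractDl ractZl linearP.
have Fa x a : F (ract x a) = ract (F x) a.
  by apply/lfunP => b; rewrite coind_actE !FE ractM.
by exists (mkhom Fl Fa) => x b; rewrite mkhomE FE.
Qed.

Lemma coind_unit_ex N :
  exists h : rhom N (coind N), forall x b, (h x : 'Hom(A, N)) b = ract x b.
Proof.
have [h hE] := coind_adj (\1%VF : 'Hom(N, N)).
by exists h => x b; rewrite hE id_lfunE.
Qed.

Definition coind_unit N : rhom N (coind N) :=
  proj1_sig (constructive_indefinite_description _ (coind_unit_ex N)).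

Lemma coind_unitE N x b : (coind_unit N x : 'Hom(A, N)) b = ract x b.
Proof. by rewrite /coind_unit; case: constructive_indefinite_description. Qed.

Lemma coind_unit_inj N : injm (coind_unit N).
Proof.
apply: injmP => x /lfunP/(_ 1).
by rewrite coind_unitE ract1 zero_lfunE.
Qed.

(* The cosyzygy of [N]: [coind N] is injective, and functorial in [N]. *)
Definition Sigma N : rmod A :=
  proj1_sig (constructive_indefinite_description _ (ses_mono (@coind_unit_inj N))).

Definition Sigma_proj N : rhom (coind N) (Sigma N) :=
  proj1_sig (constructive_indefinite_description _
    (proj2_sig (constructive_indefinite_description _ (ses_mono (@coind_unit_inj N))))).

Lemma Sigma_ses N : ses (coind_unit N) (Sigma_proj N).
Proof. exact: (proj2_sig (constructive_indefinite_description _ _)). Qed.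

Lemma coind_map_ex N N' (f : rhom N N') :
  exists h : rhom (coind N) (coind N'),
    forall phi b, (h phi : 'Hom(A, N')) b = f ((phi : 'Hom(A, N)) b).
Proof.
pose F (phi : coind N) : coind N' := (f \o (phi : 'Hom(A, N)))%VF.
have FE phi b : (F phi : 'Hom(A, N')) b = f ((phi : 'Hom(A, N)) b) by apply: comp_lfunE.
have Fl : linear F.
  by move=> k x y; apply/lfunP => b; rewrite add_lfunE scale_lfunE !FE add_lfunE scale_lfunE linearP.
have Fa x a : F (ract x a) = ract (F x) a.
  by apply/lfunP => b; rewrite coind_actE !FE coind_actE.
by exists (mkhom Fl Fa) => x b; rewrite mkhomE FE.
Qed.

Definition coind_map N N' (f : rhom N N') :=
  proj1_sig (constructive_indefinite_description _ (coind_map_ex f)).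

Lemma coind_mapE N N' (f : rhom N N') phi b :
  (coind_map f phi : 'Hom(A, N')) b = f ((phi : 'Hom(A, N)) b).
Proof. by rewrite /coind_map; case: constructive_indefinite_description. Qed.

Lemma coind_unit_nat N N' (f : rhom N N') x :
  coind_map f (coind_unit N x) = coind_unit N' (f x).
Proof. by apply/lfunP => b; rewrite coind_mapE !coind_unitE rhom_act. Qed.

Lemma coind_ses X Y Z (i : rhom X Y) (p : rhom Y Z) :
  ses i p -> ses (coind_map i) (coind_map p).
Proof.
move=> s; have [ii sp ep] := s; split=> [|phi|phi].
- apply: injmP => phi /lfunP h; apply/lfunP => b; apply: ii.
  by have := h b; rewrite coind_mapE !zero_lfunE linear0.
- exists (p^-1 \o (phi : 'Hom(A, Z)))%VF; apply/lfunP => b.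
  by rewrite coind_mapE comp_lfunE limg_lfunVK //; apply/fullvP.
split=> [h|[psi <-]]; last first.
  by apply/lfunP => b; rewrite !coind_mapE zero_lfunE (ses0 _ s).
exists (i^-1 \o (phi : 'Hom(A, Y)))%VF; apply/lfunP => b.
rewrite coind_mapE comp_lfunE limg_lfunVK //.
have /ep [x <-] : p ((phi : 'Hom(A, Y)) b) = 0; last exact/memv_img/memvf.
by rewrite -coind_mapE h zero_lfunE.
Qed.

(** By adjunction this is a lifting problem for K-linear maps, so no condition on [M] is needed. It
    replaces the splitting of the coinduced sequence in the second-variable arguments. *)
Lemma coind_lift M Y Z (p : rhom Y Z) (f : rhom M (coind Z)) : surjm p ->
  exists g : rhom M (coind Y), forall x, coind_map p (g x) = f x.
Proof.
move=> sp; pose e : 'Hom(M, Z) := linfun (fun x => (f x : 'Hom(A, Z)) 1).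
have eE x : e x = (f x : 'Hom(A, Z)) 1.
  by apply: linear_lfunE => k y z; rewrite linearP add_lfunE scale_lfunE.
have [g gE] := coind_adj (p^-1 \o e)%VF.
exists g => x; apply/lfunP => b; rewrite coind_mapE gE comp_lfunE limg_lfunVK ?eE.
  by rewrite rhom_act coind_actE mulr1.
exact/fullvP.
Qed.

Lemma Sigma_map_ses X Y Z (i : rhom X Y) (p : rhom Y Z) : ses i p ->
  exists (i' : rhom (Sigma X) (Sigma Y)) (p' : rhom (Sigma Y) (Sigma Z)),
    [/\ ses i' p',
        forall x, i' (Sigma_proj X x) = Sigma_proj Y (coind_map i x)
      & forall y, p' (Sigma_proj Y y) = Sigma_proj Z (coind_map p y)].
Proof.
move=> s; have [ii sp ep] := s.
have [ci sc ec] := coind_ses s.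
have [ux qx ex] := Sigma_ses X; have [uy qy ey] := Sigma_ses Y.
have [uz qz ez] := Sigma_ses Z.
have [|i' i'E] := desc_epi (f := rcomp (Sigma_proj Y) (coind_map i)) qx.
  by move=> x /ex [x' <-]; rewrite rcompE coind_unit_nat (ses0 _ (Sigma_ses Y)).
have [|p' p'E] := desc_epi (f := rcomp (Sigma_proj Z) (coind_map p)) qy.
  by move=> x /ey [x' <-]; rewrite rcompE coind_unit_nat (ses0 _ (Sigma_ses Z)).
exists i', p'; split=> *; rewrite ?i'E ?p'E ?rcompE //; split=> [|z|y].
- apply: injmP => x; have [phi <-] := qx x; rewrite i'E rcompE => /ey [y ye].
  have /ep [x' ix] : p y = 0.
    apply: (injm0 uz); rewrite -coind_unit_nat ye.
    by rewrite (ses0 _ (coind_ses s)).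
  apply/ex; exists x'; apply: ci; by rewrite coind_unit_nat ix.
- have [phi <-] := qz z; have [psi <-] := sc phi.
  by exists (Sigma_proj Y psi); rewrite p'E rcompE.
have [phi <-] := qy y; rewrite p'E rcompE; split=> [/ez [z ze]|[x]].
  have [y0 py] := sp z; have /ec [psi pE] : coind_map p (phi - coind_unit Y y0) = 0.
    by rewrite homB coind_unit_nat py ze subrr.
  exists (Sigma_proj X psi); rewrite i'E rcompE pE homB.
  by rewrite (ses0 _ (Sigma_ses Y)) subr0.
have [psi <-] := qx x; rewrite i'E rcompE => /eqP; rewrite -subr_eq0 -linearB.
move=> /eqP/ey [y0 ye]; rewrite -[phi](subrK (coind_map i psi)) -opprB -ye.
rewrite homD homN coind_unit_nat (ses0 _ (coind_ses s)) addr0 homN.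
by rewrite (ses0 _ (Sigma_ses Z)) oppr0.
Qed.

End Coinduced.

Section Ext.
Variables (K : fieldType) (A : falgType K).
Implicit Types (M N P X Y Z : rmod A).

(* Ext^1(M, N) = 0 *)
Variant splits M N : Prop := Splits of
  forall X (i : rhom N X) (p : rhom X M), ses i p ->
    exists r : rhom X N, forall x, r (i x) = x.

Lemma splits_ext M N X Y (i : rhom X Y) (p : rhom Y M) (f : rhom X N) :
  splits M N -> ses i p -> exists g : rhom Y N, forall x, g (i x) = f x.
Proof.
move=> [sMN] s; have [E [i' [p' [g [s' e _ _]]]]] := ses_push f s.
have [r rE] := sMN _ _ _ s'.
by exists (rcomp r g) => x; rewrite rcompE -e rE.
Qed.

Lemma splits_lift M N Y Z (i : rhom N Y) (p : rhom Y Z) (f : rhom M Z) :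
  splits M N -> ses i p -> exists g : rhom M Y, forall x, p (g x) = f x.
Proof.
move=> [sMN] s; have [E [i' [p' [g [s' _ e _]]]]] := ses_pull f s.
have [r /(ses_retr_sect s') [t [tE _]]] := sMN _ _ _ s'.
by exists (rcomp g t) => x; rewrite rcompE e tE.
Qed.

Lemma splits_sect M N X (i : rhom N X) (p : rhom X M) :
  splits M N -> ses i p -> exists s : rhom M X, forall x, p (s x) = x.
Proof.
move=> sMN s; have [g gE] := splits_lift (rid M) sMN s.
by exists g => x; rewrite gE rhE.
Qed.

Lemma splits_coind M N : splits M (coind N).
Proof.
split=> X i p [ii _ _].
pose g : 'Hom(X, N) := linfun (fun x => (i^-1%VF x : 'Hom(A, N)) 1).
have gE x : g x = (i^-1%VF x : 'Hom(A, N)) 1.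
  by apply: linear_lfunE => k y z; rewrite linearP add_lfunE scale_lfunE.
have [h hE] := coind_adj g; exists h => phi; apply/lfunP => b.
rewrite hE gE -rhom_act lker0_lfunK; last exact/lker0P.
by rewrite coind_actE mulr1.
Qed.

(** Ext^1(M, N) is the cokernel of Hom(M, [coind N]) -> Hom(M, [Sigma N]). The fragments of the long
    exact sequences below are diagram chases on this lifting criterion. *)
Lemma splitsP M N : splits M N <-> forall f : rhom M (Sigma N),
  exists g : rhom M (coind N), forall x, Sigma_proj N (g x) = f x.
Proof.
split=> [sMN f|h]; [|split=> X i p s]; first exact: splits_lift sMN (Sigma_ses N).
have [ii sp ep] := s; have [uN qN eN] := Sigma_ses N.
have [k kE] := splits_ext (coind_unit N) (splits_coind M N) s.
have [|f fE] := desc_epi (f := rcomp (Sigma_proj N) k) sp.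
  by move=> x /ep [y <-]; rewrite rcompE kE (ses0 _ (Sigma_ses N)).
have [g gE] := h f.
have [x|r rE] := lift_mono (f := rsub k (rcomp g p)) uN.
  by apply/eN; rewrite !rhE homB gE fE rcompE subrr.
exists r => x; apply: uN.
by rewrite rE !rhE (ses0 _ s) linear0 subr0 kE.
Qed.

(** * Long exact sequence in the first variable *)

Section FirstVariable.
Variables (X Y Z : rmod A) (i : rhom X Y) (p : rhom Y Z).
Hypothesis s : ses i p.

Lemma splits_mid N : splits X N -> splits Z N -> splits Y N.
Proof.
move=> sX sZ; apply/splitsP => f.
have [g gE] := (splitsP _ _).1 sX (rcomp f i).
have [ii sp ep] := s; have [uN qN eN] := Sigma_ses N.
have [g' g'E] := splits_ext g (splits_coind Z N) s.
have [|h hE] := desc_epi (f := rsub f (rcomp (Sigma_proj N) g')) sp.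
  by move=> y /ep [x <-]; rewrite !rhE g'E gE rhE subrr.
have [k kE] := (splitsP _ _).1 sZ h.
exists (radd g' (rcomp k p)) => y.
by rewrite !rhE homD kE hE !rhE addrC subrK.
Qed.

Lemma splits_left N : splits Y N -> splits Z (Sigma N) -> splits X N.
Proof.
move=> sY sZ; apply/splitsP => f.
have [g gE] := splits_ext f sZ s.
have [h hE] := (splitsP _ _).1 sY g.
by exists (rcomp h i) => x; rewrite rcompE hE gE.
Qed.

Lemma splits_right0 N :
    splits Y N -> (forall f : rhom X N, exists g : rhom Y N, forall x, g (i x) = f x) ->
  splits Z N.
Proof.
move=> sY ext; apply/splitsP => f.
have [ii sp ep] := s; have [uN qN eN] := Sigma_ses N.
have [h hE] := (splitsP _ _).1 sY (rcomp f p).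
have [x|k kE] := lift_mono (f := rcomp h i) uN.
  by apply/eN; rewrite rcompE hE rcompE (ses0 _ s) linear0.
have [k' k'E] := ext k.
have [|g gE] := desc_epi (f := rsub h (rcomp (coind_unit N) k')) sp.
  by move=> y /ep [x <-]; rewrite !rhE k'E kE rcompE subrr.
exists g => z; have [y <-] := sp z.
by rewrite gE !rhE homB hE (ses0 _ (Sigma_ses N)) subr0 rcompE.
Qed.

(** A map [X -> Sigma N] lifts to [coind N] since Ext^1(X, N) = 0, then extends to [Y] by
    injectivity; so [splits_right0] applies with [Sigma N]. *)
Lemma splits_right N : splits X N -> splits Y (Sigma N) -> splits Z (Sigma N).
Proof.
move=> sX sY; apply: splits_right0 => // f.
have [g gE] := (splitsP _ _).1 sX f.
have [g' g'E] := splits_ext g (splits_coind Z N) s.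
by exists (rcomp (Sigma_proj N) g') => x; rewrite rcompE g'E gE.
Qed.

End FirstVariable.

(** * Long exact sequence in the second variable *)

Section SecondVariable.
Variables (X Y Z : rmod A) (i : rhom X Y) (p : rhom Y Z).
Hypothesis s : ses i p.

Lemma splits_mid2 M : splits M X -> splits M Z -> splits M Y.
Proof.
have [i' [p' [s' i'E p'E]]] := Sigma_map_ses s.
have [ii' sp' ep'] := s'; have [ci sc ec] := coind_ses s.
move=> sX sZ; apply/splitsP => f.
have [g gE] := (splitsP _ _).1 sZ (rcomp p' f).
have [h hE] := coind_lift g (let: And3 _ sp _ := s in sp).
have [x|k kE] := lift_mono (f := rsub f (rcomp (Sigma_proj Y) h)) ii'.
  by apply/ep'; rewrite !rhE homB p'E hE gE rhE subrr.
have [l lE] := (splitsP _ _).1 sX k.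
exists (radd h (rcomp (coind_map i) l)) => x.
by rewrite !rhE homD -i'E lE kE !rhE addrC subrK.
Qed.

Lemma splits_left2_0 M :
    splits M Y -> (forall f : rhom M Z, exists g : rhom M Y, forall x, p (g x) = f x) ->
  splits M X.
Proof.
have [i' [p' [s' i'E p'E]]] := Sigma_map_ses s.
have [ii' sp' ep'] := s'; have [ci sc ec] := coind_ses s.
have [uZ qZ eZ] := Sigma_ses Z.
move=> sY lift; apply/splitsP => f.
have [h hE] := (splitsP _ _).1 sY (rcomp i' f).
have [x|k kE] := lift_mono (f := rcomp (coind_map p) h) uZ.
  by apply/eZ; rewrite rcompE -p'E hE rcompE (ses0 _ s').
have [k' k'E] := lift k.
have [x|g gE] := lift_mono (f := rsub h (rcomp (coind_unit Y) k')) ci.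
  by apply/ec; rewrite !rhE homB coind_unit_nat k'E kE rcompE subrr.
exists g => x; apply: ii'.
by rewrite i'E gE !rhE homB hE (ses0 _ (Sigma_ses Y)) subr0 rcompE.
Qed.

Lemma splits_left2 M : splits M Z -> splits M (Sigma Y) -> splits M (Sigma X).
Proof.
have [i' [p' [s' i'E p'E]]] := Sigma_map_ses s.
move=> sZ sY; have [ii' sp' ep'] := s'.
have s'' : ses i' p' by [].
apply/splitsP => f.
have [j [q [t jE qE]]] := Sigma_map_ses s''.
have [ij sq eq] := t; have [uZ qZ eZ] := Sigma_ses (Sigma Z).
have [ci sc ec] := coind_ses s''.
have [h hE] := (splitsP _ _).1 sY (rcomp j f).
have [x|k kE] := lift_mono (f := rcomp (coind_map p') h) uZ.
  by apply/eZ; rewrite rcompE -qE hE rcompE (ses0 _ t).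
(* As Ext^1(M, Z) = 0, [k] lifts to [coind Z] and then to [coind Y]. Its image [k'] in [Sigma Y]
   corrects [h] so that the difference lands in [coind (Sigma X)]. *)
have [l lE] := (splitsP _ _).1 sZ k.
have [l' l'E] := coind_lift l (let: And3 _ sp _ := s in sp).
pose k' := rcomp (Sigma_proj Y) l'.
have k'E x : p' (k' x) = k x by rewrite rcompE p'E l'E lE.
have [x|g gE] := lift_mono (f := rsub h (rcomp (coind_unit _) k')) ci.
  by apply/ec; rewrite [rsub _ _ x]rhE homB rcompE coind_unit_nat k'E kE rcompE subrr.
exists g => x; apply: ij.
by rewrite jE gE rsubE rcompE homB hE (ses0 _ (Sigma_ses _)) subr0 rcompE.
Qed.

Lemma splits_right2 M : splits M Y -> splits M (Sigma X) -> splits M Z.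
Proof.
have [i' [p' [s' i'E p'E]]] := Sigma_map_ses s.
move=> sY sX; apply/splitsP => f.
have [g gE] := splits_lift f sX s'.
have [h hE] := (splitsP _ _).1 sY g.
by exists (rcomp (coind_map p) h) => x; rewrite rcompE -p'E hE gE.
Qed.

End SecondVariable.

Definition retract M N : Prop :=
  exists (i : rhom M N) (p : rhom N M), forall x, p (i x) = x.

Lemma splits_retract1 M M' N : retract M M' -> splits M' N -> splits M N.
Proof.
move=> [i [p pi]] sM; apply/splitsP => f.
have [g gE] := (splitsP _ _).1 sM (rcomp f p).
by exists (rcomp g i) => x; rewrite rcompE gE rcompE pi.
Qed.

Lemma splits_retract2 M N N' : retract N N' -> splits M N' -> splits M N.
Proof.
move=> [i [p pi]] sM; split=> X j q s; have [g gE] := splits_ext i sM s.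
by exists (rcomp p g) => x; rewrite rcompE gE pi.
Qed.

(* Ext^(n+1)(M, N) = 0; beware the shift of the index. *)
Definition extz n M N : Prop := splits M (iter n (@Sigma K A) N).

End Ext.

(** * Higher Ext, projective modules and dimension shifting *)

Section ExtShift.
Variables (K : fieldType) (A : falgType K).
Implicit Types (M N P X Y Z : rmod A).

Lemma Sigma_iter_ses n X Y Z (i : rhom X Y) (p : rhom Y Z) : ses i p ->
  exists (i' : rhom (iter n (@Sigma K A) X) (iter n (@Sigma K A) Y))
         (p' : rhom (iter n (@Sigma K A) Y) (iter n (@Sigma K A) Z)), ses i' p'.
Proof.
move=> s; elim: n => [|n [i' [p' s']]]; first by exists i, p.
by have [j [q [t _ _]]] := Sigma_map_ses s'; exists j, q.
Qed.

Lemma extz_iter n m M N : extz n M (iter m (@Sigma K A) N) <-> extz (n + m) M N.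
Proof. by rewrite /extz iterD. Qed.

Section Ses.
Variables (X Y Z : rmod A) (i : rhom X Y) (p : rhom Y Z).
Hypothesis s : ses i p.

Lemma extz_mid n N : extz n X N -> extz n Z N -> extz n Y N.
Proof. exact: (splits_mid s). Qed.

Lemma extz_left n N : extz n Y N -> extz n.+1 Z N -> extz n X N.
Proof. exact: (splits_left s). Qed.

Lemma extz_right n N : extz n X N -> extz n.+1 Y N -> extz n.+1 Z N.
Proof. exact: (splits_right s). Qed.

Lemma extz_mid2 n M : extz n M X -> extz n M Z -> extz n M Y.
Proof. by have [j [q t]] := Sigma_iter_ses n s; exact: (splits_mid2 t). Qed.

Lemma extz_left2 n M : extz n M Z -> extz n.+1 M Y -> extz n.+1 M X.
Proof. by have [j [q t]] := Sigma_iter_ses n s; exact: (splits_left2 t). Qed.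

Lemma extz_right2 n M : extz n M Y -> extz n.+1 M X -> extz n M Z.
Proof. by have [j [q t]] := Sigma_iter_ses n s; exact: (splits_right2 t). Qed.

End Ses.

Lemma extz_retract1 n M M' N : retract M M' -> extz n M' N -> extz n M N.
Proof. exact: splits_retract1. Qed.

Lemma extz_coind n M N : extz n M (coind N).
Proof.
rewrite /extz; elim: n M => [|n IH] M; first exact: splits_coind.
(* The induction hypothesis, applied to the next cosyzygy as first variable, splits the sequence;
   hence that cosyzygy is a retract of a coinduced module. *)
have [g gE] := splits_sect (IH _) (Sigma_ses (iter n (@Sigma K A) (coind N))).
by apply: splits_retract2 (splits_coind _ _); exists g, (Sigma_proj _).
Qed.

Lemma projective_splits P : projective P <-> forall N, splits P N.
Proof.
split=> [pP N|h X Y p f sp]; first split=> X i p s.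
  have [ii sp ep] := s; have [g gE] := pP _ _ p (rid P) sp.
  have [|r [rE _]] := ses_sect_retr s (s := g); last by exists r.
  by move=> x; rewrite gE rhE.
by have [Z [i s]] := ses_epi sp; apply: splits_lift s.
Qed.

Lemma projective_extz n P N : projective P -> extz n P N.
Proof. by move/projective_splits; apply. Qed.

Lemma regular_generated M (x : M) : exists f : rhom (regular A) M, f (1 : A) = x.
Proof.
have Fl : linear (fun a : regular A => ract x (a : A)).
  by move=> k a b; rewrite ractDr ractZr.
have Fa (a : regular A) b : ract x (ract a b : A) = ract (ract x a) b.
  by rewrite -ractM.
by exists (mkhom Fl Fa); rewrite mkhomE ract1.
Qed.

Lemma projective_regular : projective (regular A).
Proof.
move=> X Y p f sp; have [x px] := sp (f 1).
have [g gx] := regular_generated x; exists g => a.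
have -> : a = ract (1 : regular A) a by rewrite /= mul1r.
by rewrite !rhom_act gx px.
Qed.

Lemma projective_dsum X Y : projective X -> projective Y -> projective (dsum X Y).
Proof.
move=> pX pY M N p f sp; have [g gE] := pX _ _ p (rcomp f (rinl X Y)) sp.
have [h hE] := pY _ _ p (rcomp f (rinr X Y)) sp.
exists (rcopair g h) => -[x y]; rewrite !dsE homD gE hE !dsE -homD.
by congr (f _); congr pair; rewrite /= ?addr0 ?add0r.
Qed.

Lemma projective_zero Z : is_zero Z -> projective Z.
Proof.
move=> Z0 M N p f sp; exists (rhom0 _ _) => x.
by rewrite rhE !(hom0, Z0 x).
Qed.

Lemma projective_cover_ex M : exists (P : rmod A) (p : rhom P M), projective P /\ surjm p.
Proof.
suff h (r : seq M) : exists (P : rmod A) (p : rhom P M),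
    projective P /\ forall x, x \in r -> exists y, p y = x.
  have [P [p [pP h']]] := h (vbasis fullv); exists P, p; split=> // x.
  suff /subvP/(_ x (memvf x))/memv_imgP [y _ ->] : (fullv <= limg p)%VS by exists y.
  rewrite -(span_basis (vbasisP fullv)); apply/span_subvP => z /h' [y <-].
  exact/memv_img/memvf.
elim: r => [|x r [P [p [pP h]]]].
  exists rzero, (rhom0 _ _); split=> //; apply: projective_zero => //.
  exact: rzero_is_zero.
have [f fx] := regular_generated x.
exists (dsum (regular A) P), (rcopair f p).
split=> [|z]; first exact: projective_dsum projective_regular pP.
rewrite inE => /orP [/eqP ->|/h [y <-]].
  by exists ((1 : A), 0); rewrite dsE hom0 addr0.
by exists (0, y); rewrite dsE hom0 add0r.
Qed.

Lemma syzygy_ex M : exists (X P : rmod A) (i : rhom X P) (p : rhom P M),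
  projective P /\ ses i p.
Proof.
have [P [p [pP sp]]] := projective_cover_ex M.
by have [X [i s]] := ses_epi sp; exists X, P, i, p.
Qed.

Lemma extz_syzygy n X P M N (i : rhom X P) (p : rhom P M) :
  projective P -> ses i p -> extz n.+1 M N <-> extz n X N.
Proof.
move=> pP s; split=> e; first exact: extz_left s _ _ (projective_extz _ _ pP) e.
exact: extz_right s _ _ e (projective_extz _ _ pP).
Qed.

Definition ext_pos M N : Prop := forall n, extz n M N.
(** Because of the shift in [extz], this is projective dimension at most [n]; see [pdim_leE]. *)
Definition pdz n M : Prop := forall N, extz n M N.

Lemma pdz_leq n m M : (n <= m)%N -> pdz n M -> pdz m M.
Proof. by move=> /subnKC <- h N; apply/extz_iter. Qed.

Lemma pdz_syzygy n X P M (i : rhom X P) (p : rhom P M) :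
  projective P -> ses i p -> pdz n.+1 M <-> pdz n X.
Proof. by move=> pP s; split=> h N; apply/(extz_syzygy _ _ pP s)/h. Qed.

End ExtShift.

#[local] Arguments pr_proj {K A M} p i.
#[local] Arguments pr_aug_surj {K A M} p.
#[local] Arguments pr_exact0 {K A M} p.
#[local] Arguments pr_exactS {K A M} p i.

(** * Comparison with Ext and projective dimension defined by resolutions *)

Section Resolutions.
Variables (K : fieldType) (A : falgType K).
Implicit Types (M N P X Y Z : rmod A).

Section Cons.
Variables (X P M : rmod A) (i : rhom X P) (p : rhom P M).
Hypotheses (pP : projective P) (s : ses i p).
Variable R : projres X.

Let obj (j : nat) : rmod A := if j is k.+1 then R k else P.
Let d (j : nat) : rhom (obj j.+1) (obj j) :=
  match j return rhom (obj j.+1) (obj j) with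
  | 0%N => rcomp i (pr_aug R)
  | k.+1 => pr_d R k
  end.

Lemma cons_proj j : projective (obj j).
Proof. by case: j => [|j] //=; apply: pr_proj. Qed.

Lemma cons_surj : surjm p.
Proof. by case: s. Qed.

Lemma cons_exact0 : exact_at (d 0) p.
Proof.
have [ii sp ep] := s; move=> y; split=> [/ep [x <-]|[x <-]].
  by have [z <-] := pr_aug_surj R x; exists z; rewrite rcompE.
by rewrite rcompE (ses0 _ s).
Qed.

Lemma cons_exactS j : exact_at (d j.+1) (d j).
Proof.
have [ii sp ep] := s; case: j => [|j]; last exact: (pr_exactS R j).
move=> y /=; rewrite rcompE; split=> [/(injm0 ii)/(pr_exact0 R)//|h].
by rewrite (_ : pr_aug R y = 0) ?hom0 //; apply/(pr_exact0 R).
Qed.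

Definition cons_res : projres M :=
  ProjRes cons_proj cons_surj cons_exact0 cons_exactS.

End Cons.

Section Tail.
Variables (M X : rmod A) (R : projres M) (i : rhom X (R 0%N)).
Hypothesis s : ses i (pr_aug R).

Lemma tail_aug : exists q : rhom (R 1%N) X, forall x, i (q x) = pr_d R 0%N x.
Proof.
have [ii sp ep] := s; apply: lift_mono => // x.
by apply/ep/(pr_exact0 R); exists x.
Qed.

(** The equality of objects is too weak to transport differentials, so the second clause states
    directly what vanishing of Ext of [X] means for the maps of [R]. *)
Lemma tail_res : exists T : projres X,
  [/\ forall j, T j = R j.+1 & forall n N, ext_zero n.+1 X N ->
      (forall f : rhom (R n.+2) N, (forall x, f (pr_d R n.+2 x) = 0) ->
        exists g : rhom (R n.+1) N, forall x, f x = g (pr_d R n.+1 x))].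
Proof.
have [ii sp ep] := s; have [q qE] := tail_aug.
have sq : surjm q.
  move=> x; have /(pr_exact0 R) [y dy] : pr_aug R (i x) = 0 by rewrite (ses0 _ s).
  by exists y; apply: ii; rewrite qE.
have eq : exact_at (pr_d R 1%N) q.
  move=> y; split=> [qy|[z <-]].
    by apply/(pr_exactS R); rewrite -qE qy hom0.
  apply: (injm0 ii); rewrite qE; apply/(pr_exactS R); by exists z.
exists (@ProjRes K A X (fun j => R j.+1) (fun j => pr_d R j.+1) q
  (fun j => pr_proj R j.+1) sq eq (fun j => pr_exactS R j.+1)).
by split=> // n N e f; apply: (e (@ProjRes K A X (fun j => R j.+1)
  (fun j => pr_d R j.+1) q (fun j => pr_proj R j.+1) sq eq
  (fun j => pr_exactS R j.+1))).
Qed.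

End Tail.

Lemma resolution_ex M : inhabited (projres M).
Proof.
have cov (X : rmod A) : {u : {P : rmod A & rhom P X} |
    projective (projT1 u) /\ surjm (projT2 u)}.
  apply: constructive_indefinite_description.
  by have [P [p h]] := projective_cover_ex X; exists (existT _ P p).
pose P X := projT1 (sval (cov X)); pose p X : rhom (P X) X := projT2 (sval (cov X)).
have pP X : projective (P X) by case: (proj2_sig (cov X)).
have sp X : surjm (p X) by case: (proj2_sig (cov X)).
have ker (X : rmod A) : {u : {Z : rmod A & rhom Z (P X)} | ses (projT2 u) (p X)}.
  apply: constructive_indefinite_description.
  by have [Z [i h]] := ses_epi (sp X); exists (existT _ Z i).
pose Om X := projT1 (sval (ker X)); pose k X : rhom (Om X) (P X) := projT2 (sval (ker X)).
have s X : ses (k X) (p X) by exact: (proj2_sig (ker X)).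
constructor.
refine (@ProjRes K A M (fun j => P (iter j Om M))
  (fun j => rcomp (k (iter j Om M)) (p (iter j.+1 Om M))) (p M)
  (fun j => pP _) (@sp M) _ _).
  move=> y; split=> [|[x <-]]; last by rewrite rcompE (ses0 _ (s _)).
  case: (s M) => _ _ e /e [x <-]; have [z <-] := sp _ x.
  by exists z; rewrite rcompE.
move=> j y; rewrite rcompE; split=> [|[x <-]].
  case: (s (iter j Om M)) => ik _ _ /(injm0 ik).
  case: (s (iter j.+1 Om M)) => _ _ e /e [x <-]; have [z <-] := sp _ x.
  by exists z; rewrite rcompE.
by rewrite rcompE [p (iter j.+1 Om M) _](ses0 _ (s _)) hom0.
Qed.

(** In degree 1 both sides say that maps from the first syzygy extend to the projective. Higher
    degrees follow by shifting: a resolution of the syzygy is prolonged by [cons_res] for one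
    direction, and an arbitrary resolution is cut by [tail_res] for the other. *)
Lemma ext_zeroE n M N : ext_zero n.+1 M N <-> extz n M N.
Proof.
elim: n M => [|n IH] M; split.
- move=> e; have [R] := resolution_ex M.
  have [X [i s]] := ses_epi (pr_aug_surj R).
  have [q qE] := tail_aug s; have [ii sp ep] := s.
  have sq : surjm q.
    move=> x; have /(pr_exact0 R) [y dy] : pr_aug R (i x) = 0 by rewrite (ses0 _ s).
    by exists y; apply: ii; rewrite qE.
  have pR0 := pr_proj R 0%N.
  apply: (splits_right0 s); first exact: (projective_splits _).1.
  move=> f; have [x|g gE] := e R (rcomp f q).
    rewrite rcompE (_ : q _ = 0) ?hom0 //; apply: (injm0 ii); rewrite qE.
    by apply/(pr_exactS R); exists x.
  by exists g => x; have [y <-] := sq x; rewrite qE -gE rcompE.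
- move=> e R f f0.
  have [X [i s]] := ses_epi (pr_aug_surj R).
  have [q qE] := tail_aug s; have [ii sp ep] := s.
  have sq : surjm q.
    move=> x; have /(pr_exact0 R) [y dy] : pr_aug R (i x) = 0 by rewrite (ses0 _ s).
    by exists y; apply: ii; rewrite qE.
  have [x|g gE] := desc_epi (f := f) sq.
    move=> qx; have /(pr_exactS R) [y <-] : pr_d R 0%N x = 0 by rewrite -qE qx hom0.
    exact: f0.
  have [h hE] := splits_ext g e s.
  by exists h => x; rewrite -qE hE gE.
- move=> e; have [X [P [i [p [pP s]]]]] := syzygy_ex M.
  apply/(extz_syzygy _ _ pP s)/IH => R.
  exact: (e (cons_res pP s R)).
move=> e R f f0; have [X [i s]] := ses_epi (pr_aug_surj R).
have [T [_ h]] := tail_res s; apply: h f0.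
by apply/IH/(extz_syzygy _ _ (pr_proj R 0%N) s).
Qed.

Lemma ext_pos_zeroE M N : ext_pos_zero M N <-> ext_pos M N.
Proof.
split=> [h n|h [//|n] _]; first by apply/ext_zeroE/h.
exact/ext_zeroE/h.
Qed.

Lemma pdim_leE n M : pdim_le n M <-> pdz n M.
Proof.
elim: n M => [|n IH] M; split.
- move=> [R R0].
  have ii : injm (pr_aug R).
    by apply: injmP => x /(pr_exact0 R) [y <-]; rewrite [y]R0 ?hom0.
  have [g [g1 g2]] := inv_hom ii (pr_aug_surj R) => N.
  apply: (@extz_retract1 _ _ 0%N M (R 0%N)); first by exists g, (pr_aug R).
  exact/projective_extz/pr_proj.
- move=> h; have pM : projective M by apply/projective_splits => N; apply: h.
  pose Z := @rzero K A; have Z0 : is_zero Z by apply: rzero_is_zero.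
  have s : ses (rhom0 Z M) (rid M).
    split=> [x y _|x|y]; first by rewrite [x]Z0 [y]Z0.
      by exists x; rewrite rhE.
    rewrite rhE; split=> [->|[x <-]]; last by rewrite rhE.
    by exists 0; rewrite rhE.
  have ex0 (f g : rhom Z Z) : exact_at f g.
    by move=> y; split=> _; [exists 0; rewrite hom0 [y]Z0 | rewrite [g y]Z0].
  have sZ : surjm (rid Z) by move=> y; exists y; rewrite rhE.
  pose R := @ProjRes K A Z (fun=> Z) (fun=> rid Z) (rid Z)
    (fun=> projective_zero Z0) sZ (ex0 _ _) (fun=> ex0 _ _).
  by exists (cons_res pM s R) => -[|j].
- move=> [R R0]; have [X [i s]] := ses_epi (pr_aug_surj R).
  apply/(pdz_syzygy _ (pr_proj R 0%N) s)/IH.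
  have [T [TE _]] := tail_res s.
  by exists T => j nj; rewrite TE; apply: R0.
move=> h; have [X [P [i [p [pP s]]]]] := syzygy_ex M.
have /IH [R R0] : pdz n X by apply/(pdz_syzygy _ pP s).
by exists (cons_res pP s R) => -[//|j] nj; apply: R0.
Qed.

End Resolutions.

(** * Additive closures and approximations *)

Section Add.
Variables (K : fieldType) (A : falgType K).
Implicit Types (M N P T U X Y Z : rmod A).

Definition power T m : rmod A := \big[@dsum K A/rzero]_(i < m) T.

Lemma power0 T : power T 0 = rzero.
Proof. exact: big_ord0. Qed.

Lemma powerS T m : power T m.+1 = dsum T (power T m).
Proof. exact: big_ord_recl. Qed.

Lemma retract_refl M : retract M M.
Proof. by exists (rid M), (rid M) => x; rewrite !rhE. Qed.

Lemma retract_trans N M P : retract M N -> retract N P -> retract M P.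
Proof.
move=> [i [p pi]] [j [q qj]]; exists (rcomp j i), (rcomp p q) => x.
by rewrite !rhE qj pi.
Qed.

Lemma retract_dsum M N M' N' :
  retract M N -> retract M' N' -> retract (dsum M M') (dsum N N').
Proof.
move=> [i [p pi]] [j [q qj]].
exists (rpair (rcomp i (rfst M M')) (rcomp j (rsnd M M'))).
exists (rpair (rcomp p (rfst N N')) (rcomp q (rsnd N N'))) => -[x y].
by rewrite !dsE pi qj.
Qed.

Lemma retract_inl M N : retract M (dsum M N).
Proof. by exists (rinl M N), (rfst M N) => x; rewrite !dsE. Qed.

Lemma retract_inr M N : retract N (dsum M N).
Proof. by exists (rinr M N), (rsnd M N) => x; rewrite !dsE. Qed.

Lemma retract_zero Z M : is_zero Z -> retract Z M.
Proof. by move=> Z0; exists (rhom0 Z M), (rhom0 M Z) => x; rewrite rhE [x]Z0. Qed.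

Lemma retract_iso M N (f : rhom M N) : injm f -> surjm f -> retract M N.
Proof. by move=> fi fs; have [g [gf _]] := inv_hom fi fs; exists f, g. Qed.

Lemma retract_iso' M N (f : rhom M N) : injm f -> surjm f -> retract N M.
Proof. by move=> fi fs; have [g [_ fg]] := inv_hom fi fs; exists g, f. Qed.

Lemma split_iso X Y Z (i : rhom X Y) (p : rhom Y Z) (r : rhom Y X) :
    ses i p -> (forall x, r (i x) = x) ->
  exists f : rhom (dsum X Z) Y, injm f /\ surjm f.
Proof.
move=> s ri; have [t [pt tp]] := ses_retr_sect s ri; have [ii sp ep] := s.
exists (rcopair i t); split.
  apply: injmP => -[x z]; rewrite dsE /= => e.
  have z0 : z = 0.
    by have := congr1 p e; rewrite homD (ses0 _ s) add0r pt hom0.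
  by move: e; rewrite z0 hom0 addr0 => /(injm0 ii) ->.
by move=> y; exists (r y, p y); rewrite dsE /= tp addrC subrK.
Qed.

Lemma retract_compl M N : retract M N -> exists M', iso (dsum M M') N.
Proof.
move=> [i [p pi]].
have [|M' [q s]] := @ses_mono _ _ _ _ i.
  by apply: injmP => x e; rewrite -[x]pi e hom0.
have [f [fi fs]] := split_iso s pi.
by exists M', f; apply: bij_hom.
Qed.

Lemma in_addP T M : in_add T M <-> exists m, retract M (power T m).
Proof.
split=> [[m [N [f [g fg gf]]]]|[m h]].
  exists m; apply: (retract_trans (retract_inl M N)).
  apply: (@retract_iso _ _ f) => [x y e|y]; first by rewrite -[x]fg -[y]fg e.
  by exists (g y).
by have [N h'] := retract_compl h; exists m, N.
Qed.

Lemma in_add_retract T M N : retract M N -> in_add T N -> in_add T M.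
Proof.
by move=> r /in_addP [m h]; apply/in_addP; exists m; apply: retract_trans h.
Qed.

Lemma in_add_power T m : in_add T (power T m).
Proof. by apply/in_addP; exists m; apply: retract_refl. Qed.

Lemma in_add_zero T Z : is_zero Z -> in_add T Z.
Proof. by move=> Z0; apply/in_addP; exists 0%N; apply: retract_zero. Qed.

Lemma in_add_dsum T M N : in_add T M -> in_add T N -> in_add T (dsum M N).
Proof.
move=> /in_addP [m hm] /in_addP [n hn]; apply/in_addP; exists (m + n)%N.
apply: retract_trans (retract_dsum hm hn) _.
elim: m {hm} => [|m IH]; last first.
  rewrite addSn !powerS.
  apply: retract_trans (retract_dsum (retract_refl T) IH).
  have [f [fi fs]] : exists f : rhom (dsum (dsum T (power T m)) (power T n))
      (dsum T (dsum (power T m) (power T n))), injm f /\ surjm f.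
    pose a := rcomp (rfst T (power T m)) (rfst _ (power T n)).
    pose b := rcomp (rsnd T (power T m)) (rfst _ (power T n)).
    exists (rpair a (rpair b (rsnd _ _))); rewrite /a /b; split.
      by apply: injmP => -[[x y] z]; rewrite !dsE => -[/= -> -> ->].
    by move=> [x [y z]]; exists ((x, y), z); rewrite !dsE.
  exact: retract_iso fi fs.
rewrite power0 add0n; apply: (@retract_iso _ _ (rsnd _ _)); last first.
  by move=> y; exists (0, y); rewrite dsE.
apply: injmP => -[x y]; rewrite dsE /= => ->.
by rewrite [x](@rzero_is_zero K A).
Qed.

Lemma in_add_ind (D : rmod A -> Prop) T :
    (forall Z, is_zero Z -> D Z) -> (forall M N, D M -> D N -> D (dsum M N)) ->
    (forall M N, retract M N -> D N -> D M) -> D T ->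
  forall M, in_add T M -> D M.
Proof.
move=> D0 DD Dr DT M /in_addP [m /Dr]; apply; elim: m => [|m IH].
  by rewrite power0; apply/D0/rzero_is_zero.
by rewrite powerS; apply: DD.
Qed.

Lemma in_add_refl T : in_add T T.
Proof.
apply/in_addP; exists 1%N; rewrite powerS; exact: retract_inl.
Qed.

Lemma in_add_of_retract T M : retract M T -> in_add T M.
Proof. by move/in_add_retract; apply; apply: in_add_refl. Qed.

Lemma in_add_trans T U M : in_add T U -> in_add U M -> in_add T M.
Proof.
move=> TU; move: M; apply: in_add_ind => //.
- exact: in_add_zero.
- by move=> *; apply: in_add_dsum.
- by move=> M N; apply: in_add_retract.
Qed.

Lemma Sigma_map_ex N N' (f : rhom N N') : exists g : rhom (Sigma N) (Sigma N'),
  forall x, g (Sigma_proj N x) = Sigma_proj N' (coind_map f x).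
Proof.
have [u q e] := Sigma_ses N.
have [|g gE] := desc_epi (f := rcomp (Sigma_proj N') (coind_map f)) q.
  by move=> x /e [y <-]; rewrite rhE coind_unit_nat (ses0 _ (Sigma_ses N')).
by exists g => x; rewrite gE rhE.
Qed.

Lemma Sigma_retract N N' : retract N N' -> retract (Sigma N) (Sigma N').
Proof.
move=> [i [p pi]]; have [j jE] := Sigma_map_ex i; have [q qE] := Sigma_map_ex p.
exists j, q => x; have [_ s _] := Sigma_ses N; have [y <-] := s x.
rewrite jE qE; congr (Sigma_proj N _); apply/lfunP => b.
by rewrite !coind_mapE pi.
Qed.

Lemma extz_retract2 n M N N' : retract N N' -> extz n M N' -> extz n M N.
Proof.
move=> r; have : retract (iter n (@Sigma K A) N) (iter n (@Sigma K A) N').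
  by elim: n => [|n IH] //=; apply: Sigma_retract.
exact: splits_retract2.
Qed.

Lemma extz_zero1 n Z N : is_zero Z -> extz n Z N.
Proof. by move=> Z0; apply/projective_extz/projective_zero. Qed.

Lemma extz_zero2 n M Z : is_zero Z -> extz n M Z.
Proof.
move=> Z0; apply: (@extz_retract2 _ _ _ (coind Z)); first exact: retract_zero.
exact: extz_coind.
Qed.

Lemma extz_dsum1 n M M' N : extz n M N -> extz n M' N -> extz n (dsum M M') N.
Proof. exact: extz_mid (ses_split_sum M M') n N. Qed.

Lemma extz_dsum2 n M N N' : extz n M N -> extz n M N' -> extz n M (dsum N N').
Proof. exact: extz_mid2 (ses_split_sum N N') n M. Qed.

Lemma extz_add1 n T N M : extz n T N -> in_add T M -> extz n M N.
Proof.
move=> e; move: M; apply: in_add_ind => //.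
- by move=> Z Z0; apply: extz_zero1.
- by move=> M M'; apply: extz_dsum1.
- by move=> M M'; apply: extz_retract1.
Qed.

Lemma extz_add2 n M T N : extz n M T -> in_add T N -> extz n M N.
Proof.
move=> e; move: N; apply: in_add_ind => //.
- by move=> Z Z0; apply: extz_zero2.
- by move=> N N'; apply: extz_dsum2.
- by move=> N N'; apply: extz_retract2.
Qed.

Lemma ext_pos_add1 T N M : ext_pos T N -> in_add T M -> ext_pos M N.
Proof. by move=> h a n; apply: extz_add1 a. Qed.

Lemma ext_pos_add2 M T N : ext_pos M T -> in_add T N -> ext_pos M N.
Proof. by move=> h a n; apply: extz_add2 a. Qed.

Lemma rperp_addP T N : rperp (in_add T) N <-> ext_pos T N.
Proof.
split=> [h|h M TM]; first exact/ext_pos_zeroE/h/in_add_refl.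
exact/ext_pos_zeroE/(ext_pos_add1 h).
Qed.

Lemma lperp_addP T M : lperp (in_add T) M <-> ext_pos M T.
Proof.
split=> [h|h N TN]; first exact/ext_pos_zeroE/h/in_add_refl.
exact/ext_pos_zeroE/(ext_pos_add2 h).
Qed.

(** [rhom M N] is not itself a vector space here. Homomorphisms outside the current span are added
    inside the space of K-linear maps, whose dimension bounds the process. The spanning maps become
    the components of the approximations below. *)
Lemma hom_span M N : exists hs : seq (rhom M N),
  forall h : rhom M N, rhom_lin h \in <<map (@rhom_lin K A M N) hs>>%VS.
Proof.
pose S hs : {vspace 'Hom(M, N)} := <<map (@rhom_lin K A M N) hs>>%VS.
have [d] := ubnP (dim 'Hom(M, N) - \dim (S [::])).
elim: d [::] => // d IH hs; rewrite ltnS => le_d.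
have [?|/not_all_ex_not [h /negP nh]] :=
  classic (forall h : rhom M N, rhom_lin h \in S hs); first by exists hs.
apply: (IH (h :: hs)); apply: leq_trans le_d.
have lt : (\dim (S hs) < \dim (S (h :: hs)))%N.
  have sub : (S hs <= S (h :: hs))%VS by rewrite /S /= span_cons addvSr.
  rewrite ltnNge; apply: contra nh => le.
  have /eqP -> : S hs == S (h :: hs) by rewrite eqEdim sub.
  by rewrite memv_span //= mem_head.
have := dimvS (subvf (S (h :: hs))); rewrite dimvf.
by move: lt; set a := \dim _; set b := \dim _; set c := dim _; lia.
Qed.

Lemma left_approx M T : exists (m : nat) (g : rhom M (power T m)),
  forall h : rhom M T, exists k : rhom (power T m) T, forall x, k (g x) = h x.
Proof.
have [hs hsE] := hom_span M T.
suff [m [g gE]] : exists (m : nat) (g : rhom M (power T m)),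
    forall h : rhom M T, rhom_lin h \in <<map (@rhom_lin K A M T) hs>>%VS ->
    exists k : rhom (power T m) T, forall x, k (g x) = h x.
  by exists m, g => h; apply: gE.
elim: hs {hsE} => [|h0 hs [m [g IH]]].
  exists 0%N, (rhom0 _ _) => h; rewrite span_nil memv0 => /eqP h0.
  by exists (rhom0 _ _) => x; rewrite !rhE h0 zero_lfunE.
exists m.+1; rewrite powerS; exists (rpair h0 g) => h.
rewrite span_cons => /memv_addP [u /vlineP [c ->] [v vs e]].
have ve : v = rhom_lin (rsub h (rscale c h0)).
  by apply/lfunP => x; rewrite !rhE e add_lfunE scale_lfunE addrC addKr.
have [k kE] := IH (rsub h (rscale c h0)) (eq_rect _ (fun w => w \in _) vs _ ve).
exists (rcopair (rscale c (rid T)) k) => x.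
by rewrite !dsE /= kE !rhE addrC subrK.
Qed.

Lemma right_approx T N : exists (m : nat) (g : rhom (power T m) N),
  forall h : rhom T N, exists k : rhom T (power T m), forall x, g (k x) = h x.
Proof.
have [hs hsE] := hom_span T N.
suff [m [g gE]] : exists (m : nat) (g : rhom (power T m) N),
    forall h : rhom T N, rhom_lin h \in <<map (@rhom_lin K A T N) hs>>%VS ->
    exists k : rhom T (power T m), forall x, g (k x) = h x.
  by exists m, g => h; apply: gE.
elim: hs {hsE} => [|h0 hs [m [g IH]]].
  exists 0%N, (rhom0 _ _) => h; rewrite span_nil memv0 => /eqP h0.
  by exists (rhom0 _ _) => x; rewrite !rhE h0 zero_lfunE.
exists m.+1; rewrite powerS; exists (rcopair h0 g) => h.
rewrite span_cons => /memv_addP [u /vlineP [c ->] [v vs e]].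
have ve : v = rhom_lin (rsub h (rscale c h0)).
  by apply/lfunP => x; rewrite !rhE e add_lfunE scale_lfunE addrC addKr.
have [k kE] := IH (rsub h (rscale c h0)) (eq_rect _ (fun w => w \in _) vs _ ve).
exists (rpair (rscale c (rid T)) k) => x.
by rewrite !dsE /= kE !rhE homZ addrC subrK.
Qed.

Lemma left_approx_add M X T (g : rhom M X) :
    (forall h : rhom M T, exists k : rhom X T, forall x, k (g x) = h x) ->
  forall U, in_add T U ->
  forall h : rhom M U, exists k : rhom X U, forall x, k (g x) = h x.
Proof.
move=> gT; apply: in_add_ind => //.
- by move=> Z Z0 h; exists (rhom0 _ _) => x; rewrite rhE [h x]Z0.
- move=> N N' hN hN' h; have [k kE] := hN (rcomp (rfst N N') h).
  have [l lE] := hN' (rcomp (rsnd N N') h).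
  by exists (rpair k l) => x; rewrite dsE kE lE !dsE -surjective_pairing.
move=> N N' [i [p pi]] hN' h; have [k kE] := hN' (rcomp i h).
by exists (rcomp p k) => x; rewrite rcompE kE rcompE pi.
Qed.

Lemma right_approx_add N X T (g : rhom X N) :
    (forall h : rhom T N, exists k : rhom T X, forall x, g (k x) = h x) ->
  forall U, in_add T U ->
  forall h : rhom U N, exists k : rhom U X, forall x, g (k x) = h x.
Proof.
move=> gT; apply: in_add_ind => //.
- by move=> Z Z0 h; exists (rhom0 _ _) => x; rewrite rhE [x]Z0 !hom0.
- move=> M M' hN hN' h; have [k kE] := hN (rcomp h (rinl M M')).
  have [l lE] := hN' (rcomp h (rinr M M')).
  exists (rcopair k l) => -[x y]; rewrite dsE homD kE lE !dsE -homD.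
  by congr (h _); congr pair; rewrite /= ?addr0 ?add0r.
move=> M M' [i [p pi]] hN' h; have [k kE] := hN' (rcomp h p).
by exists (rcomp k i) => x; rewrite rcompE kE rcompE pi.
Qed.

End Add.

(** * Tilting modules *)

Lemma nat_least (P : nat -> Prop) : (exists n, P n) ->
  exists n, P n /\ forall m, (m < n)%N -> ~ P m.
Proof.
move=> [n]; elim/ltn_ind: n => n IH Pn.
have [[m [mn Pm]]|h] := classic (exists m, (m < n)%N /\ P m); first exact: IH Pm.
by exists n; split=> // m mn Pm; apply: h; exists m.
Qed.

Section Tilting.
Variables (K : fieldType) (A : falgType K).
Implicit Types (M N P T U X Y Z W : rmod A).

Definition generates T : Prop := forall N, ext_pos T N ->
  forall x : N, exists (m : nat) (f : rhom (power T m) N) (y : power T m), f y = x.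

(* With [generates], i.e. T^perp consisting of quotients of sums of copies of
   [T], in place of the coresolution of [A]; see [tiltingP]. *)
Definition tilting_gen T : Prop :=
  [/\ ext_pos T T, generates T & exists d, pdz d T].

(* The class ^perp(T^perp). *)
Definition perp_closure T M : Prop := forall N, ext_pos T N -> ext_pos M N.

Lemma lperp_rperpP T M : lperp (rperp (in_add T)) M <-> perp_closure T M.
Proof.
split=> [h N /rperp_addP TN|h N /rperp_addP TN]; first exact/ext_pos_zeroE/h.
exact/ext_pos_zeroE/h.
Qed.

Lemma perp_closure_proj T P : projective P -> perp_closure T P.
Proof. by move=> pP N _ n; apply: projective_extz. Qed.

Lemma perp_closure_add T M : in_add T M -> perp_closure T M.
Proof. by move=> TM N TN; apply: ext_pos_add1 TM. Qed.

Section PerpClosureSes.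
Variables (T X Y Z : rmod A) (i : rhom X Y) (p : rhom Y Z).
Hypothesis s : ses i p.

Lemma perp_closure_mid : perp_closure T X -> perp_closure T Z -> perp_closure T Y.
Proof. by move=> hX hZ N TN n; apply: (extz_mid s); [apply: hX|apply: hZ]. Qed.

Lemma perp_closure_left : perp_closure T Y -> perp_closure T Z -> perp_closure T X.
Proof. by move=> hY hZ N TN n; apply: (extz_left s); [apply: hY|apply: hZ]. Qed.

Lemma ext_pos_mid2 : ext_pos T X -> ext_pos T Z -> ext_pos T Y.
Proof. by move=> hX hZ n; apply: (extz_mid2 s). Qed.

Lemma ext_pos_right2 : ext_pos T Y -> ext_pos T X -> ext_pos T Z.
Proof. by move=> hY hX n; apply: (extz_right2 s). Qed.

End PerpClosureSes.

(** If [T] has projective dimension at most [d], every d-th cosyzygy lies in T^perp; so Ext^(d+1)(M,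
    N) is an Ext^1 from [M] into T^perp. *)
Lemma perp_closure_pdz d T M : pdz d T -> perp_closure T M -> pdz d M.
Proof.
move=> pT h N; have TN : ext_pos T (iter d (@Sigma K A) N).
  by move=> n; apply/extz_iter; apply: pdz_leq pT _; lia.
exact: (h _ TN 0%N).
Qed.

(** Induction on the length: the cokernel of [eta] has a shorter coresolution, hence no Ext into
    [N], and so maps extend along [eta]. Here [d] counts the terms, one more than the last index. *)
Lemma coresolution_extend d T M (C : nat -> rmod A) (eta : rhom M (C 0%N))
    (del : forall i, rhom (C i) (C i.+1)) N :
    (forall i, in_add T (C i)) -> (forall i, (d <= i)%N -> is_zero (C i)) ->
    injm eta -> exact_at eta (del 0%N) -> (forall i, exact_at (del i) (del i.+1)) ->
    ext_pos T N ->
  ext_pos M N /\ forall f : rhom M N, exists g : rhom (C 0%N) N, forall x, g (eta x) = f x.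
Proof.
elim: d M C eta del => [|d IH] M C eta del TC C0 ieta e0 eS TN.
  have M0 : is_zero M by move=> x; apply: (injm0 ieta); rewrite [eta x](C0 0%N).
  split=> [n|f]; first exact: extz_zero1.
  by exists (rhom0 _ _) => x; rewrite rhE [x]M0 hom0.
have [Z [q s]] := ses_mono ieta; have [_ sq eq] := s.
have [|eta' eE] := desc_epi (f := del 0%N) sq.
  by move=> y /eq [x <-]; apply/e0; exists x.
have [|||||hZ _] := IH Z (fun i => C i.+1) eta' (fun i => del i.+1) _ _ _ _ _ TN.
- by move=> i; apply: TC.
- by move=> i di; apply: C0.
- apply: injmP => z; have [y <-] := sq z; rewrite eE => /e0 [x <-].
  exact: (ses0 _ s).
- move=> y; split=> [/eS [x <-]|[z <-]]; first by exists (q x); rewrite eE.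
  by have [x <-] := sq z; rewrite eE; apply/eS; exists x.
- by move=> i; apply: eS.
split=> [n|f].
  by apply: (extz_left s); [exact: extz_add1 (TC 0%N)|exact: hZ].
exact: splits_ext (hZ 0%N) s.
Qed.

Lemma tilting_tilting_gen T : tilting T -> tilting_gen T.
Proof.
move=> [d [[/pdim_leE pT _] /ext_pos_zeroE TT [C [eta [del [TC C0 ieta e0 eS]]]]]].
split=> //; last by exists d.
have TC' i : in_add T (C i).
  have [/TC//|di] := leqP i d; exact/in_add_zero/C0.
move=> N TN x; have [f fx] := regular_generated x.
have [_ /(_ f) [g gE]] := coresolution_extend (d := d.+1) TC' C0 ieta e0 eS TN.
have /in_addP [m [i [p pi]]] := TC' 0%N.
by exists m, (rcomp g p), (i (eta (1 : A))); rewrite rhE pi gE.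
Qed.

Fixpoint coresolved T n M : Prop :=
  if n is k.+1 then exists (X Z : rmod A) (i : rhom M X) (p : rhom X Z),
    [/\ ses i p, in_add T X & coresolved T k Z]
  else in_add T M.

Lemma coresolved_seq T n M : coresolved T n M ->
  exists (C : nat -> rmod A) (eta : rhom M (C 0%N))
         (del : forall i, rhom (C i) (C i.+1)),
    [/\ forall i, (i <= n)%N -> in_add T (C i),
        forall i, (n < i)%N -> is_zero (C i),
        injm eta, exact_at eta (del 0%N)
      & forall i, exact_at (del i) (del i.+1)].
Proof.
elim: n M => [|n IH] M /=.
  move=> TM; exists (fun i => if i is 0%N then M else rzero), (rid M).
  exists (fun i => rhom0 _ _); split=> [[]|[]|x y|y|i y] //.
  - by move=> i _; apply: rzero_is_zero.
  - by rewrite !rhE.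
  - by rewrite rhE; split=> // _; exists y; rewrite rhE.
  split=> [_|[x <-]]; last by rewrite !rhE.
  by exists 0; rewrite rhE [y](@rzero_is_zero K A).
move=> [X [Z [i [p [s TX /IH [C [eta [del [TC C0 ieta e0 eS]]]]]]]]].
have [ii sp ep] := s.
exists (fun j => if j is k.+1 then C k else X), i.
exists (fun j => match j return rhom (if j is k.+1 then C k else X) (C j) with
  | 0%N => rcomp eta p | k.+1 => del k end).
split=> //.
- by case.
- by case.
- move=> x; rewrite rhE; split=> [/(injm0 ieta)/ep//|/ep ->]; exact: hom0.
case=> [|j]; last exact: eS.
move=> y; rewrite e0; split=> [[z <-]|[x <-]].
  by have [x <-] := sp z; exists x; rewrite rhE.
by exists (p x); rewrite rhE.
Qed.

Section TiltingGen.
Variable T : rmod A.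
Hypothesis tT : tilting_gen T.

(** A right add [T]-approximation is onto because [T] generates. Its kernel has no Ext^1 from [T] by
    the approximation property, and no higher Ext by dimension shifting. *)
Lemma resolve_perp N : ext_pos T N ->
  exists (m : nat) (X : rmod A) (i : rhom X (power T m)) (p : rhom (power T m) N),
    ses i p /\ ext_pos T X.
Proof.
have [TT gT _] := tT; move=> TN; have [m [g gE]] := right_approx T N.
have sg : surjm g.
  move=> x; have [k [f [y <-]]] := gT N TN x.
  have [h hE] := right_approx_add gE (in_add_power T k) f.
  by exists (h y).
have [X [i s]] := ses_epi sg; exists m, X, i, g; split=> // -[|n].
  by apply: (splits_left2_0 s) => //; apply: (ext_pos_add2 TT (in_add_power T m)) 0%N.
by apply: (extz_left2 s); [exact: TN|exact: (ext_pos_add2 TT (in_add_power T m))].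
Qed.

Lemma perp_closure_in_add M : perp_closure T M -> ext_pos T M -> in_add T M.
Proof.
move=> LM TM; have [m [X [i [p [s TX]]]]] := resolve_perp TM.
have [g gE] := splits_sect (LM X TX 0%N) s.
by apply: in_add_retract (in_add_power T m); exists g, p.
Qed.

(** Each step of the add [T]-resolution of [N] raises the degree of Ext by one and stays in T^perp,
    until the degree exceeds the projective dimension of [X]; [k] counts the remaining steps. *)
Lemma ext_pos_perp_closure m X : pdz m X -> ext_pos X T -> perp_closure T X.
Proof.
move=> pX XT; suff h k N n : (m <= n + k)%N -> ext_pos T N -> extz n X N.
  by move=> N TN n; apply: (h m) TN; rewrite leq_addl.
elim: k N n => [|k IH] N n mn TN.
  by apply: pdz_leq pX _; rewrite addn0 in mn.
have [l [Y [i [p [s TY]]]]] := resolve_perp TN.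
apply: (extz_right2 s); first exact: (ext_pos_add2 XT (in_add_power T l)).
by apply: IH TY; lia.
Qed.

(** Salce's argument: take the preimage of [M] in an add [T]-cover of [E]. It is an extension of [M]
    by the kernel of the cover, and the kernel of a map from add [T] onto [Z]. *)
Lemma special_precover_of_preenvelope M E Z (i : rhom M E) (p : rhom E Z) :
    ses i p -> ext_pos T E -> perp_closure T Z ->
  exists (Y X : rmod A) (j : rhom Y X) (q : rhom X M),
    [/\ ses j q, ext_pos T Y & perp_closure T X].
Proof.
move=> s TE LZ; have [m [Y [j [q [t TY]]]]] := resolve_perp TE.
have [G [j' [q' [g [s1 s2 _ _]]]]] := ses_noether t s.
exists Y, G, j', q'; split=> //; apply: (perp_closure_left s2) LZ.
exact/perp_closure_add/in_add_power.
Qed.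

(** Induction on the number of cosyzygies after which [M] enters T^perp, at most the projective
    dimension of [T]. Pulling [Sigma_ses M] back along a precover of [Sigma M] gives a middle term
    that is an extension of [coind M] by a module of T^perp. *)
Lemma special_preenvelope M : exists (E Z : rmod A) (i : rhom M E) (p : rhom E Z),
  [/\ ses i p, ext_pos T E & perp_closure T Z].
Proof.
have [TT gT [d pT]] := tT.
have : ext_pos T (iter d (@Sigma K A) M).
  by move=> n; apply/extz_iter; apply: pdz_leq pT _; lia.
elim: d M {pT} => [|d IH] M TM.
  exists M, rzero, (rid M), (rhom0 _ _); split=> //.
    apply: ses_id (@rzero_is_zero K A) => [x y|y]; first by rewrite !rhE.
    by exists y; rewrite rhE.
  exact/perp_closure_add/in_add_zero/rzero_is_zero.
have [|E [Z [i [p [s TE LZ]]]]] := IH (Sigma M); first by rewrite -iterSr.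
have [Y [X [j [q [t TY LX]]]]] := special_precover_of_preenvelope s TE LZ.
have [E' [i' [p' [k' [q' [s1 s2 _ _ _]]]]]] := ses_pull2 (Sigma_ses M) t.
exists E', X, i', p'; split=> //; apply: (ext_pos_mid2 s2) => // n.
exact: extz_coind.
Qed.

Lemma special_precover M : exists (Y X : rmod A) (j : rhom Y X) (q : rhom X M),
  [/\ ses j q, ext_pos T Y & perp_closure T X].
Proof.
have [E [Z [i [p [s TE LZ]]]]] := special_preenvelope M.
exact: special_precover_of_preenvelope s TE LZ.
Qed.

(** The envelope of a module in ^perp(T^perp) lies in both classes, so in add [T]. Passing to the
    cokernel lowers by one the degree in which Ext is assumed to vanish, and in the last degree the
    sequence splits. *)
Lemma perp_closure_coresolved n M : perp_closure T M ->
  (forall W, perp_closure T W -> extz n W M) -> coresolved T n M.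
Proof.
have [TT gT _] := tT.
elim: n M => [|n IH] M LM h; have [E [Z [i [p [s TE LZ]]]]] := special_preenvelope M.
  have LE := perp_closure_mid s LM LZ.
  have [r rE] : exists r : rhom E M, forall x, r (i x) = x.
    have [g gE] := splits_ext (rid M) (h Z LZ) s.
    by exists g => x; rewrite gE rhE.
  by apply: in_add_retract (perp_closure_in_add LE TE); exists i, r.
have LE := perp_closure_mid s LM LZ.
have aE := perp_closure_in_add LE TE.
exists E, Z, i, p; split=> //; apply: IH => // W LW.
apply: (extz_right2 s); last exact: h.
by apply: extz_add2 aE; apply: LW.
Qed.

Lemma tilting_gen_tilting : tilting T.
Proof.
(* The least bound is taken, since the exact projective dimension must also be the length of the
   coresolution. *)
have [TT gT pT] := tT; have [d [pd min_d]] := nat_least pT.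
exists d; split; first by split=> [|m md /pdim_leE]; [exact/pdim_leE|exact: min_d].
  exact/ext_pos_zeroE.
apply/coresolved_seq/perp_closure_coresolved.
  exact/perp_closure_proj/projective_regular.
by move=> W LW; apply: perp_closure_pdz LW _.
Qed.

End TiltingGen.

Lemma tiltingP T : tilting T <-> tilting_gen T.
Proof. by split; [apply: tilting_tilting_gen|apply: tilting_gen_tilting]. Qed.

End Tilting.

(** * Fitting decompositions *)

Section Fitting.
Variables (K : fieldType) (A : falgType K).
Implicit Types (M N P T U V X Y Z W : rmod A).

Lemma subspace_ex (V : vectType K) (P : V -> Prop) :
    P 0 -> (forall k x y, P x -> P y -> P (k *: x + y)) ->
  exists U : {vspace V}, forall x, x \in U <-> P x.
Proof.
move=> P0 PD; suff [U [UP PU]] : exists U : {vspace V}, (forall x, x \in U -> P x) /\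
    forall x, P x -> x \in U.
  by exists U => x; split; [apply: UP|apply: PU].
have : forall x, x \in (0%VS : {vspace V}) -> P x by move=> x; rewrite memv0 => /eqP ->.
have [d] := ubnP (dim V - \dim (0%VS : {vspace V})).
elim: d (0%VS : {vspace V}) => // d IH U; rewrite ltnS => le_d UP.
have [[x [Px nx]]|h] := classic (exists x, P x /\ x \notin U); last first.
  exists U; split=> // x Px; apply: contraT => nx.
  by case: h; exists x.
apply: (IH (<[x]> + U)%VS); last first.
  by move=> y /memv_addP [u /vlineP [k ->] [v vU ->]]; apply/PD/UP.
apply: leq_trans le_d.
have lt : (\dim U < \dim (<[x]> + U))%N.
  have sub : (U <= <[x]> + U)%VS by rewrite addvSr.
  rewrite ltnNge; apply: contra nx => le.
  have /eqP -> : U == (<[x]> + U)%VS by rewrite eqEdim sub.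
  by apply: (subvP (addvSl _ _)); apply: memv_line.
have := dimvS (subvf (<[x]> + U)); rewrite dimvf.
by move: lt; set a := \dim _; set b := \dim _; set c := dim _; lia.
Qed.

Lemma dim_dsum X Y : dim (dsum X Y) = (dim X + dim Y)%N.
Proof. by []. Qed.

Lemma dim_zero X : (dim X = 0)%N -> is_zero X.
Proof.
move=> d0 x; apply/eqP; rewrite -memv0.
have /eqP <- : (fullv : {vspace X}) == 0%VS by rewrite -dimv_eq0 dimvf d0.
exact: memvf.
Qed.

Lemma is_zero_dim X : is_zero X -> (dim X = 0)%N.
Proof.
move=> X0; apply/eqP; rewrite -dimvf dimv_eq0 -subv0; apply/subvP => x _.
by rewrite [x]X0 mem0v.
Qed.

Lemma dim_ses X Y Z (i : rhom X Y) (p : rhom Y Z) : ses i p ->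
  dim Y = (dim X + dim Z)%N.
Proof.
move=> [ii sp ep].
have := limg_ker_dim p fullv; rewrite capfv !dimvf => <-.
have -> : limg p = fullv by apply/vspaceP => z; rewrite memvf; apply/fullvP.
have <- : limg i = lker p.
  apply/vspaceP => y; rewrite memv_ker; apply/memv_imgP/eqP => [[x _ ->]|/ep [x <-]].
    by apply/ep; exists x.
  by exists x; rewrite ?memvf.
by rewrite limg_dim_eq ?dimvf //; move/lker0P/eqP: ii ->; rewrite capv0.
Qed.

Lemma endo_surj_inj X (f : rhom X X) : surjm f -> injm f.
Proof.
move=> sf; have [Z [i s]] := ses_epi sf; have := dim_ses s; rewrite -{1}[dim X]add0n.
move/addIn => /esym/dim_zero Z0; have [_ _ e] := s; apply: injmP => x /e [z <-].
by rewrite [z]Z0 hom0.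
Qed.

Lemma endo_inj_surj X (f : rhom X X) : injm f -> surjm f.
Proof.
move=> fi; have [Z [p s]] := ses_mono fi; have := dim_ses s; rewrite -{1}[dim X]addn0.
move/addnI => /esym/dim_zero Z0; have [_ _ e] := s => x; apply/e.
by rewrite [p x]Z0.
Qed.

Fixpoint hiter X k (f : rhom X X) : rhom X X :=
  if k is j.+1 then rcomp f (hiter j f) else rid X.

Lemma hiterE X k (f : rhom X X) x : hiter k f x = iter k f x.
Proof. by elim: k => [|k IH] /=; rewrite rhE // IH. Qed.

(* Here [i o p] is the Fitting idempotent of [f]: [f] is invertible on its
   image and nilpotent on its kernel. *)
Lemma fitting X (f : rhom X X) :
  exists (V : rmod A) (i : rhom V X) (p : rhom X V) (g : rhom X X) (k : nat),
    [/\ forall v, p (i v) = v, forall x, iter k f (i (p x)) = iter k f x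
      & forall x, g (f x) = i (p x)].
Proof.
(* A power of [f] of least rank has the same image as its square, so it is bijective on that image.
   The exponent is [k.+1], so that a factor [f] can be split off in the last clause. *)
pose D d := exists k, d = \dim (limg (hiter k.+1 f)).
have [d [[k dk] min_d]] : exists d, D d /\ forall m, (m < d)%N -> ~ D m.
  by apply: nat_least; exists (\dim (limg (hiter 1 f))), 0%N.
set g := hiter k.+1 f in dk.
have gE x : g x = iter k.+1 f x by rewrite hiterE.
have ggE x : g (g x) = hiter (k.+1 + k.+1) f x by rewrite !gE hiterE iterD.
have imgg : limg g = limg (rcomp g g).
  apply/eqP; rewrite eq_sym eqEdim; apply/andP; split.
    by apply/subvP => y /memv_imgP [x _ ->]; rewrite rcompE memv_img ?memvf.
  rewrite -dk leqNgt; apply/negP => lt; apply: (min_d _ lt); exists (k + k.+1)%N.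
  by rewrite -addSn; congr (\dim (lfun_img _ _)); apply/lfunP => x; rewrite -ggE rcompE.
have [V [p [i [sp ii ip]]]] := image_fact g.
have spi : surjm (rcomp p i).
  move=> v; have [x px] := sp v.
  have : i v \in limg (rcomp g g) by rewrite -imgg -px ip memv_img ?memvf.
  move=> /memv_imgP [y _]; rewrite rcompE -ip => /ii e.
  by exists (p y); rewrite rcompE ip e.
have [u [u1 u2]] := inv_hom (endo_surj_inj spi) spi.
have upi v : u (p (i v)) = v by rewrite -[RHS]u1 rcompE.
have piu v : p (i (u v)) = v by rewrite -[RHS]u2 rcompE.
exists V, i, (rcomp u p), (rcomp i (rcomp u (rcomp u (rcomp p (hiter k f))))), k.+1.
split=> [v|x|x]; first by rewrite rcompE upi.
  by rewrite -!gE -!ip !rhE piu.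
by rewrite !rhE hiterE -iterSr -gE -ip upi.
Qed.

Definition nilhom X (f : rhom X X) : Prop := exists k, forall x, iter k f x = 0.
Definition linvhom X (f : rhom X X) : Prop := exists g : rhom X X, forall x, g (f x) = x.

(* Indecomposable or zero, expressed by idempotent endomorphisms. *)
Definition prim X : Prop := forall V (i : rhom V X) (p : rhom X V),
  (forall v, p (i v) = v) -> is_zero V \/ forall x, i (p x) = x.

Lemma prim_endo X (f : rhom X X) : prim X -> nilhom f \/ linvhom f.
Proof.
move=> pX; have [V [i [p [g [k [pi fk gf]]]]]] := fitting f.
have [V0|ip] := pX _ _ _ pi; [left|right].
  exists k => x; rewrite -fk [p x]V0 hom0.
  by elim: k {fk} => //= k ->; rewrite hom0.
by exists g => x; rewrite gf ip.
Qed.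

Lemma nilp_fixed X (f : rhom X X) x : nilhom f -> f x = x -> x = 0.
Proof.
move=> [k fk] fx; have := fk x.
by have -> : iter k f x = x by elim: k {fk} => //= k ->.
Qed.

Lemma nilp_not_linv X (f : rhom X X) : ~ is_zero X -> nilhom f -> ~ linvhom f.
Proof.
move=> nX [k fk] [g gf]; apply: nX => x.
elim: k fk => [|k IH] fk; first exact: fk.
by apply: IH => y; rewrite -[LHS]gf -iterS fk hom0.
Qed.

Lemma inj_linv X (f : rhom X X) : injm f -> linvhom f.
Proof.
by move=> fi; have [g [gf _]] := inv_hom fi (endo_inj_surj fi); exists g.
Qed.

(** The endomorphism ring is local: were the composite left invertible, [f] would be too. So the
    nilpotent endomorphisms are stable under left composition. *)
Lemma nilp_comp X (e f : rhom X X) : prim X -> ~ is_zero X -> nilhom f -> nilhom (rcomp e f).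
Proof.
move=> pX nX nf; have [//|[g gE]] := prim_endo (rcomp e f) pX.
case: (nilp_not_linv nX nf); exists (rcomp g e) => x.
by rewrite rcompE -[RHS]gE rcompE.
Qed.

(** The Krull-Schmidt exchange: the identity of [X] is a + b, with [a] through [P] and [b] through
    [Q]. If [a] is nilpotent, [b] has no kernel, since on it [a] is the identity. *)
Lemma prim_retract_dsum X P Q : prim X -> retract X (dsum P Q) ->
  retract X P \/ retract X Q.
Proof.
move=> pX [i [p pi]].
pose a := rcomp (rcomp p (rinl P Q)) (rcomp (rfst P Q) i).
pose b := rcomp (rcomp p (rinr P Q)) (rcomp (rsnd P Q) i).
have ab x : a x + b x = x.
  rewrite /a /b !dsE -homD -[RHS]pi; congr (p _).
  by rewrite [i x]surjective_pairing; congr pair; rewrite /= ?addr0 ?add0r.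
have [na|[g gE]] := prim_endo a pX; [right|left]; last first.
  exists (rcomp (rfst P Q) i), (rcomp g (rcomp p (rinl P Q))) => x.
  by rewrite -[RHS]gE /a !rhE.
have [|g gE] := @inj_linv _ b.
  apply: injmP => x bx; apply: (nilp_fixed na).
  by have := ab x; rewrite bx addr0.
exists (rcomp (rsnd P Q) i), (rcomp g (rcomp p (rinr P Q))) => x.
by rewrite -[RHS]gE /b !rhE.
Qed.

Lemma prim_in_add X T : prim X -> ~ is_zero X -> in_add T X -> retract X T.
Proof.
move=> pX nX /in_addP [m]; elim: m => [|m IH].
  rewrite power0 => -[i [p pi]]; case: nX => x.
  by rewrite -[LHS]pi [i x](@rzero_is_zero K A) hom0.
by rewrite powerS => /(prim_retract_dsum pX) [].
Qed.

Section Loewy.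
Variable X : rmod A.
Hypotheses (pX : prim X) (nX : ~ is_zero X).

(* The Loewy filtration of [X] over its local endomorphism ring. *)
Fixpoint loewy k (x : X) : Prop :=
  if k is j.+1 then forall r : rhom X X, nilhom r -> loewy j (r x) else x = 0.

Lemma loewy0 k : loewy k 0.
Proof. by elim: k => //= k IH r _; rewrite hom0. Qed.

Lemma loewyP k c x y : loewy k x -> loewy k y -> loewy k (c *: x + y).
Proof.
elim: k x y => [|k IH] x y /=; first by move=> -> ->; rewrite scaler0 addr0.
by move=> hx hy r nr; rewrite homD homZ; apply: IH; [apply: hx|apply: hy].
Qed.

Lemma loewyD k x y : loewy k x -> loewy k y -> loewy k (x + y).
Proof. by move=> hx hy; rewrite -[x]scale1r; apply: loewyP. Qed.

Lemma loewyS k x : loewy k x -> loewy k.+1 x.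
Proof.
elim: k x => [|k IH] x /=; first by move=> -> r _; rewrite hom0.
by move=> h r nr s ns; apply: (IH _ _ s ns); apply: h.
Qed.

(* Otherwise choose [x] with minimal orbit [E x]: if [r x] is still outside,
   then [x = e r x] with [e r] nilpotent. *)
Lemma loewy_grow k x : ~ loewy k x -> exists y, loewy k.+1 y /\ ~ loewy k y.
Proof.
have orb (z : X) : exists U : {vspace X}, forall y, y \in U <-> exists e : rhom X X, y = e z.
  apply: subspace_ex; first by exists (rhom0 X X); rewrite rhE.
  by move=> c y y' [e ->] [f ->]; exists (radd (rscale c e) f); rewrite !rhE.
move=> nx; suff h d (y : X) (U : {vspace X}) : (forall z, z \in U <-> exists e : rhom X X, z = e y) ->
    (\dim U < d)%N -> ~ loewy k y -> exists z, loewy k.+1 z /\ ~ loewy k z.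
  by have [U UP] := orb x; apply: (h (\dim U).+1 x U).
elim: d y U {x nx} => // d IH y U UP; rewrite ltnS => le_d ny.
have [[r [nr nry]]|hy] := classic (exists r : rhom X X, nilhom r /\ ~ loewy k (r y)); last first.
  by exists y; split=> // r nr; apply: NNPP => nry; apply: hy; exists r.
have [V VP] := orb (r y).
have VU : (V <= U)%VS.
  by apply/subvP => z /VP [e ->]; apply/UP; exists (rcomp e r); rewrite rcompE.
have [UV|UV] := boolP (U <= V)%VS.
  have /(subvP UV)/VP [e ye] : y \in U by apply/UP; exists (rid X); rewrite rhE.
  case: ny; rewrite (nilp_fixed (nilp_comp e pX nX nr) (x := y)) ?rcompE //.
  exact: loewy0.
apply: (IH (r y) V VP) => //; apply: leq_trans le_d.
rewrite ltn_neqAle dimvS // andbT; apply: contra UV => /eqP e.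
by have /eqP <- : V == U by rewrite eqEdim VU e /=.
Qed.

Lemma loewy_full : exists k, forall x, loewy k x.
Proof.
apply: NNPP => h.
have grow k : exists y, loewy k.+1 y /\ ~ loewy k y.
  have /not_all_ex_not [x nx] : ~ forall x, loewy k x by move=> hk; apply: h; exists k.
  exact: loewy_grow nx.
have vs k : exists U : {vspace X}, forall y, y \in U <-> loewy k y.
  by apply: subspace_ex => [|c x y]; [exact: loewy0|exact: loewyP].
have [U [_]] : exists U : {vspace X}, (forall y, y \in U <-> loewy (dim X).+1 y) /\
    (dim X < \dim U)%N; last first.
  by apply/negP; rewrite -leqNgt -dimvf; apply/dimvS/subvf.
elim: (dim X).+1 => [|k [U [UP dU]]].
  by have [U UP] := vs 0%N; exists U.
have [V VP] := vs k.+1; exists V; split=> //.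
have [y [y1 y2]] := grow k; apply: leq_ltn_trans dU _.
have sub : (U <= V)%VS by apply/subvP => z /UP/loewyS/VP.
rewrite ltnNge; apply/negP => le; apply: y2; apply/UP.
by have /eqP -> : U == V; [rewrite eqEdim sub|apply/VP].
Qed.

End Loewy.

End Fitting.

(** * Lowering a tilting module *)

Section FinitePdim.
Variables (K : fieldType) (A : falgType K) (o : option nat).
Implicit Types (M N P T U V X Y Z W : rmod A).

Definition fpd M : Prop := if o is Some m then pdz m M else exists m, pdz m M.

Lemma PnE M : Pn o M <-> fpd M.
Proof.
rewrite /fpd /Pn; case: o => [m|]; first exact: pdim_leE.
by split=> -[m /pdim_leE h]; exists m; apply/pdim_leE; move/pdim_leE: h.
Qed.

Lemma fpd_pdz M : fpd M -> exists m, pdz m M.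
Proof. by rewrite /fpd; case: o => [m h|//]; exists m. Qed.

(** Lets finite and infinite n share their proofs: one argues with a common bound and returns to P_n
    by the last clause. *)
Lemma fpd_common M N : fpd M -> fpd N ->
  exists n, [/\ pdz n M, pdz n N & forall X, pdz n X -> fpd X].
Proof.
rewrite /fpd; case: o => [m hM hN|]; first by exists m.
move=> [m hM] [n hN]; exists (maxn m n); split; last by move=> X h; exists (maxn m n).
- exact: pdz_leq (leq_maxl m n) hM.
- exact: pdz_leq (leq_maxr m n) hN.
Qed.

Section Ses.
Variables (X Y Z : rmod A) (i : rhom X Y) (p : rhom Y Z).
Hypothesis s : ses i p.

Lemma fpd_mid : fpd X -> fpd Z -> fpd Y.
Proof.
move=> hX hZ; have [n [pX pZ]] := fpd_common hX hZ; apply => N.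
by apply: (extz_mid s); [apply: pX|apply: pZ].
Qed.

Lemma fpd_left : fpd Y -> fpd Z -> fpd X.
Proof.
move=> hY hZ; have [n [pY pZ]] := fpd_common hY hZ; apply => N.
by apply: (extz_left s); [apply: pY|apply: pdz_leq pZ N].
Qed.

End Ses.

Lemma fpd_retract M N : retract M N -> fpd N -> fpd M.
Proof.
move=> r hN; have [n [pN _]] := fpd_common hN hN; apply => X.
exact: extz_retract1 r (pN X).
Qed.

Lemma fpd_dsum M N : fpd M -> fpd N -> fpd (dsum M N).
Proof. exact: fpd_mid (ses_split_sum M N). Qed.

Lemma fpd_proj P : projective P -> fpd P.
Proof.
move=> pP; rewrite /fpd; case: o => [m|]; last exists 0%N; move=> N;
  exact: projective_extz.
Qed.

Lemma fpd_zero Z : is_zero Z -> fpd Z.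
Proof. by move=> Z0; apply/fpd_proj/projective_zero. Qed.

Lemma fpd_add T M : fpd T -> in_add T M -> fpd M.
Proof.
move=> hT; move: M; apply: in_add_ind => //.
- exact: fpd_zero.
- by move=> *; apply: fpd_dsum.
- by move=> M N; apply: fpd_retract.
Qed.

(* Monomorphisms with cokernel in P_n. *)
Definition pmono X Y (f : rhom X Y) : Prop :=
  exists (C : rmod A) (p : rhom Y C), ses f p /\ fpd C.

Lemma pmono_eq X Y (f g : rhom X Y) : (forall x, f x = g x) -> pmono f -> pmono g.
Proof.
move=> fg [C [p [[fi sp ep] hC]]]; exists C, p; split=> //; split=> //.
  by move=> x y; rewrite -!fg; apply: fi.
by move=> y; rewrite ep; split=> -[x <-]; exists x.
Qed.

Lemma pmono_comp X Y Z (f : rhom X Y) (g : rhom Y Z) :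
  pmono f -> pmono g -> pmono (rcomp g f).
Proof.
move=> [C [p [s hC]]] [D [q [t hD]]].
have [E [c [a [b [s' t']]]]] := ses_noether' s t.
by exists E, c; split=> //; apply: fpd_mid t' hC hD.
Qed.

Lemma pmono_iso X Y (f : rhom X Y) : injm f -> surjm f -> pmono f.
Proof.
move=> fi fs; exists rzero, (rhom0 _ _); split; last exact/fpd_zero/rzero_is_zero.
exact: ses_id fi fs (@rzero_is_zero K A).
Qed.

Lemma pmono_split X Y (f : rhom X Y) (r : rhom Y X) :
  (forall x, r (f x) = x) -> fpd Y -> pmono f.
Proof.
move=> rf hY; have [|C [p s]] := @ses_mono _ _ _ _ f.
  by apply: injmP => x e; rewrite -[x]rf e hom0.
have [t [pt _]] := ses_retr_sect s rf.
exists C, p; split=> //; apply: fpd_retract hY.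
by exists t, p.
Qed.

Lemma pmono_dsum X Y X' Y' (f : rhom X Y) (g : rhom X' Y') : pmono f -> pmono g ->
  pmono (rpair (rcomp f (rfst X X')) (rcomp g (rsnd X X'))).
Proof.
move=> [C [p [s hC]]] [D [q [t hD]]]; exists (dsum C D).
eexists; split; first exact: (ses_dsum s t).
exact: fpd_dsum.
Qed.

(* [Y -> C (+) Y' -> C'] is exact, where [C] and [C'] are the cokernels of [f]
   and of [g f]. *)
Lemma pmono_factor X Y Y' (f : rhom X Y) (g : rhom Y Y') :
  fpd Y -> pmono (rcomp g f) -> pmono f.
Proof.
move=> hY [C' [q [s' hC']]]; have [igf sq eq] := s'.
have fi : injm f by apply: injmP => x e; apply: (injm0 igf); rewrite rcompE e hom0.
have [C [p s]] := ses_mono fi; have [_ sp ep] := s.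
have [|u uE] := desc_epi (f := rcomp q g) sp.
  by move=> y /ep [x <-]; rewrite rcompE; apply/eq; exists x; rewrite rcompE.
have t : ses (rpair p g) (rcopair (rscale (-1) u) q).
  split=> [|z|[c y']].
  - apply: injmP => y; rewrite dsE => -[/ep [x <-]].
    by rewrite -rcompE => /(injm0 igf) ->; rewrite hom0.
  - by have [y <-] := sq z; exists (0, y); rewrite !dsE hom0 scaler0 add0r.
  rewrite !dsE /=; split=> [|[y]].
    have [y <-] := sp c; rewrite uE rcompE scaleN1r addrC => /subr0_eq e.
    have /eq [x ex] : q (y' - g y) = 0 by rewrite homB e subrr.
    exists (y + f x); rewrite dsE !homD (ses0 _ s) addr0.
    by rewrite -[g (f x)]rcompE ex addrC subrK.
  by rewrite dsE => -[<- <-]; rewrite uE rcompE scaleN1r addNr.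
exists C, p; split=> //; apply: fpd_retract (retract_inl C Y') _.
exact: fpd_mid t hY hC'.
Qed.

Definition add_embeds Z X : Prop :=
  exists (W : rmod A) (f : rhom X W), in_add Z W /\ pmono f.

Lemma add_embeds_dsum Z X Y : add_embeds Z X -> add_embeds Z Y -> add_embeds Z (dsum X Y).
Proof.
move=> [W [f [aW pf]]] [W' [f' [aW' pf']]]; exists (dsum W W').
eexists; split; first exact: in_add_dsum.
exact: pmono_dsum pf pf'.
Qed.

Lemma add_embeds_retract Z X Y : retract X Y -> fpd Y -> add_embeds Z Y -> add_embeds Z X.
Proof.
move=> [i [p pi]] hY [W [f [aW pf]]]; exists W, (rcomp f i); split=> //.
by apply: pmono_comp pf; apply: pmono_split pi hY.
Qed.

Lemma add_embeds_add Z T X : fpd T -> add_embeds Z T -> in_add T X -> add_embeds Z X.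
Proof.
move=> hT ZT aX; suff [] : fpd X /\ add_embeds Z X by [].
move: X aX; apply: in_add_ind => // [Y Y0|X Y [hX eX] [hY eY]|X Y r [hY eY]].
- split; first exact: fpd_zero.
  exists rzero, (rhom0 _ _); split; first exact/in_add_zero/rzero_is_zero.
  apply: pmono_iso => [x y _|y]; first by rewrite [x]Y0 [y]Y0.
  by exists 0; rewrite rhE [y](@rzero_is_zero K A).
- by split; [apply: fpd_dsum|apply: add_embeds_dsum].
- by split; [apply: fpd_retract hY|apply: add_embeds_retract eY].
Qed.

Lemma add_embeds_trans Z T X : fpd T -> add_embeds Z T -> add_embeds T X -> add_embeds Z X.
Proof.
move=> hT ZT [W [f [aW pf]]].
have [W' [g [aW' pg]]] := add_embeds_add hT ZT aW.
by exists W', (rcomp g f); split=> //; apply: pmono_comp.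
Qed.

Lemma swap_iso X Y X' Y' : exists f : rhom (dsum (dsum X Y) (dsum X' Y'))
    (dsum (dsum X X') (dsum Y Y')),
  [/\ injm f, surjm f & forall u, f u = ((u.1.1, u.2.1), (u.1.2, u.2.2))].
Proof.
pose a := rfst (dsum X Y) (dsum X' Y'); pose b := rsnd (dsum X Y) (dsum X' Y').
pose f := rpair (rpair (rcomp (rfst _ _) a) (rcomp (rfst _ _) b))
                (rpair (rcomp (rsnd _ _) a) (rcomp (rsnd _ _) b)).
have fE u : f u = ((u.1.1, u.2.1), (u.1.2, u.2.2)) by rewrite /f /a /b !dsE.
exists f; split=> // [|[[x x'] [y y']]]; last by exists ((x, y), (x', y')); rewrite fE.
by apply: injmP => -[[x y] [x' y']]; rewrite fE => -[/= -> -> -> ->].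
Qed.

Section Eliminate.
Variables (X Z P W : rmod A) (g : rhom X (dsum P W)).
Hypotheses (pX : prim X) (nX : ~ is_zero X) (hX : fpd X) (hZ : fpd Z).
Hypotheses (aP : in_add X P) (aW : in_add Z W) (pg : pmono g).
Hypothesis ng : forall h : rhom P X, nilhom (rcomp h (rcomp (rfst P W) g)).

(** [Q] embeds into add [X] plus add [Z] so that the add [X] component drops one Loewy layer. Layers
    are defined only in [X], so elements of [Q] are measured through all maps to [X]. *)
Let good Q := exists (Q' W' : rmod A) (f : rhom Q (dsum Q' W')),
  [/\ in_add X Q', in_add Z W', pmono f &
      forall k y, (forall t : rhom Q X, loewy k.+1 (t y)) ->
      forall h : rhom Q' X, loewy k (h (f y).1)].

Lemma eliminate_step Q : in_add X Q -> good Q.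
Proof.
move=> aQ; suff [] : fpd Q /\ good Q by [].
move: Q aQ; apply: in_add_ind => [Q Q0|Q R [hQ gQ] [hR gR]|Q R [i [p pi]] [hR gR]|].
- split; first exact: fpd_zero.
  have Z0 := @rzero_is_zero K A.
  exists rzero, rzero, (rhom0 _ _); split; [exact: in_add_zero|exact: in_add_zero| |].
    apply: pmono_iso => [x y _|[x y]]; first by rewrite [x]Q0 [y]Q0.
    by exists 0; rewrite rhE [x]Z0 [y]Z0.
  by move=> k y _ h; rewrite rhE hom0; apply: loewy0.
- split; first exact: fpd_dsum.
  have [Q' [W1 [f [aQ' aW1 pf fP]]]] := gQ; have [R' [W2 [e [aR' aW2 pe eP]]]] := gR.
  have [sw [swi sws swE]] := swap_iso Q' W1 R' W2.
  exists (dsum Q' R'), (dsum W1 W2).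
  exists (rcomp sw (rpair (rcomp f (rfst Q R)) (rcomp e (rsnd Q R)))).
  split; [exact: in_add_dsum|exact: in_add_dsum| |move=> k [y z] yzP h].
    by apply: pmono_comp (pmono_dsum pf pe) (pmono_iso swi sws).
  rewrite rcompE swE !dsE /=.
  have -> : h ((f y).1, (e z).1) = rcomp h (rinl _ _) (f y).1 + rcomp h (rinr _ _) (e z).1.
    by rewrite !dsE -homD; congr (h _); congr pair; rewrite /= ?addr0 ?add0r.
  apply: loewyD.
    by apply: fP => t; have := yzP (rcomp t (rfst Q R)); rewrite !dsE.
  by apply: eP => t; have := yzP (rcomp t (rsnd Q R)); rewrite !dsE.
- split; first by apply: fpd_retract hR; exists i, p.
  have [R' [W' [f [aR' aW' pf fP]]]] := gR.
  exists R', W', (rcomp f i); split=> // [|k y yP h].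
    exact: pmono_comp (pmono_split pi hR) pf.
  rewrite rcompE; apply: fP => t.
  by have := yP (rcomp t i); rewrite rcompE.
split=> //; exists P, W, g; split=> // k y yP h.
by have := yP (rid X) _ (ng h); rewrite !dsE.
Qed.

(** [X] cogenerates add [X]; hence a component in layer 0 is zero, and only add [Z] remains. *)
Lemma eliminate_end Q : in_add X Q -> forall y : Q, (forall t : rhom Q X, t y = 0) -> y = 0.
Proof.
move: Q; apply: in_add_ind => [Q Q0 y _|Q R hQ hR [y z] yz|Q R [i [p pi]] hR y yP|y yP].
- exact: Q0.
- rewrite [y]hQ; last by move=> t; have := yz (rcomp t (rfst Q R)); rewrite !dsE.
  by rewrite [z]hR // => t; have := yz (rcomp t (rsnd Q R)); rewrite !dsE.
- rewrite -[y]pi [i y]hR ?hom0 // => t.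
  by have := yP (rcomp t i); rewrite rcompE.
- by have := yP (rid X); rewrite rhE.
Qed.

(* Substituting the components [X -> X], which are radical, into themselves
   moves the image into add Z, as the Loewy length of [X] is finite. *)
Lemma eliminate : add_embeds Z X.
Proof.
have [k kP] := loewy_full pX nX.
suff h j Q V (u : rhom X (dsum Q V)) : in_add X Q -> in_add Z V -> pmono u ->
    (forall x (t : rhom Q X), loewy j (t (u x).1)) -> add_embeds Z X.
  have Z0 := @rzero_is_zero K A.
  apply: (h k X rzero (rinl _ _)) => //; [exact: in_add_refl|exact: in_add_zero|].
  apply: pmono_iso => [x y|[x y]]; first by rewrite !dsE => -[].
  by exists x; rewrite dsE [y]Z0.
elim: j Q V u => [|j IH] Q V u aQ aV pu uP.
  exists V, (rcomp (rsnd Q V) u); split=> //.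
  apply: (@pmono_factor _ _ _ _ (rinr Q V)); first exact: fpd_add aV.
  apply: pmono_eq pu => x; rewrite !dsE [LHS]surjective_pairing; congr pair.
  by apply: (eliminate_end aQ) => t; apply: uP.
have [Q' [W' [f [aQ' aW' pf fP]]]] := eliminate_step aQ.
pose e := rpair (rcomp f (rfst Q V)) (rcomp (rid V) (rsnd Q V)).
pose a := rfst (dsum Q' W') V; pose b := rsnd (dsum Q' W') V.
pose as3 := rpair (rcomp (rfst Q' W') a) (rpair (rcomp (rsnd Q' W') a) b).
have as3E v : as3 v = (v.1.1, (v.1.2, v.2)) by rewrite /as3 /a /b !dsE.
apply: (IH Q' (dsum W' V) (rcomp as3 (rcomp e u))) => //.
- exact: in_add_dsum.
- apply: pmono_comp; first apply: pmono_comp pu _.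
    apply: pmono_dsum pf _; apply: pmono_iso => [x y|y]; first by rewrite !rhE.
    by exists y; rewrite rhE.
  apply: pmono_iso => [|[x [y z]]]; last by exists ((x, y), z); rewrite as3E.
  by apply: injmP => -[[x y] z]; rewrite as3E => -[/= -> -> ->].
move=> x t; rewrite rcompE as3E /e !dsE /=.
by apply: fP => t'; apply: uP.
Qed.

End Eliminate.

Lemma in_add_sum_retract T X Z T0 : retract T (dsum X Z) -> in_add T T0 ->
  exists P W, [/\ in_add X P, in_add Z W & retract T0 (dsum P W)].
Proof.
move=> r; move: T0; apply: in_add_ind => [Q Q0|M N [P [W [aP aW rM]]] [P' [W' [aP' aW' rN]]]|M N r' [P [W [aP aW rN]]]|].
- have Z0 := @rzero_is_zero K A.
  by exists rzero, rzero; split; [exact: in_add_zero|exact: in_add_zero|exact: retract_zero].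
- exists (dsum P P'), (dsum W W'); split; [exact: in_add_dsum|exact: in_add_dsum|].
  apply: retract_trans (retract_dsum rM rN) _.
  have [f [fi fs _]] := swap_iso P W P' W'; exact: retract_iso fi fs.
- by exists P, W; split=> //; apply: retract_trans rN.
- by exists X, Z; split=> //; apply: in_add_refl.
Qed.

End FinitePdim.

Section Lowering.
Variables (K : fieldType) (A : falgType K) (o : option nat).
Implicit Types (M N P U V X Y Z W : rmod A).
Variable T : rmod A.
Hypotheses (tT : tilting_gen T) (hT : fpd o T).

Definition nonsplit X Y (f : rhom X Y) : Prop :=
  ~ exists r : rhom Y X, forall x, r (f x) = x.

Definition nonsplit_add X : Prop := in_add T X /\ exists (T0 : rmod A) (f : rhom X T0),
  [/\ in_add T T0, pmono o f & nonsplit f].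

(** [k] bounds the degrees in which Ext(Y, T) may survive, and passing to the kernel of an add
    [T]-cover lowers it. If that kernel is in add [T], either the cover splits and puts [Y] in add
    [T], or it is the nonsplit sequence wanted. *)
Lemma perp_in_add_or k Y : ext_pos T Y -> fpd o Y -> (forall n, (k <= n)%N -> extz n Y T) ->
  in_add T Y \/ exists X, nonsplit_add X.
Proof.
have [TT _ _] := tT; elim: k Y => [|k IH] Y TY hY YT.
  left; apply: (perp_closure_in_add tT) TY.
  have [m pY] := fpd_pdz hY; apply: (ext_pos_perp_closure tT) pY _ => n.
  exact: YT.
have [m [X [i [p [s TX]]]]] := resolve_perp tT TY.
have aP := in_add_power T m.
have [||aX|] := IH X TX; [|move=> n kn| |by right].
- exact: fpd_left s (fpd_add hT aP) hY.
- by apply: (extz_left s); [exact: extz_add1 (TT n) aP|exact: YT].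
have [[r rP]|ns] := classic (exists r : rhom (power T m) X, forall x, r (i x) = x).
  have [t [tP _]] := ses_retr_sect s rP.
  by left; apply: in_add_retract aP; exists t, p.
by right; exists X; split=> //; exists (power T m), i; split=> //; exists Y, p.
Qed.

Lemma nonsplit_add_ex X : fpd o X -> ~ ext_pos X T -> exists X, nonsplit_add X.
Proof.
move=> hX nX; have [TT _ _] := tT.
have [E [Z [i [p [s TE LZ]]]]] := special_preenvelope tT X.
have hE : fpd o E.
  apply: (fpd_mid s) => //; have [n [pT _ hn]] := fpd_common hT hT.
  exact/hn/(perp_closure_pdz pT).
have [m pE] := fpd_pdz hE.
have [|aE|//] := @perp_in_add_or m E TE hE; first by move=> n mn; apply: pdz_leq pE T.
case: nX => n; apply: (extz_left s); last exact: LZ.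
exact: ext_pos_add1 aE n.
Qed.

(* If [V] were a proper nonzero summand of [X], then [f] would split on [V], by
   minimality, hence also on the complement ker(a f) of [V] cut out by a
   splitting [a : T0 -> V], and so on [X]. *)
Lemma nonsplit_add_prim X : nonsplit_add X ->
  (forall Y, (dim Y < dim X)%N -> ~ nonsplit_add Y) -> prim X.
Proof.
move=> [aX [T0 [f [aT0 pf ns]]]] minX V i p pi.
have hX := fpd_add hT aX.
have small W (j : rhom W X) (q : rhom X W) : (forall w, q (j w) = w) ->
    (dim W < dim X)%N -> exists t : rhom T0 W, forall w, t (f (j w)) = w.
  move=> qj lt; apply: NNPP => nt; apply: (minX _ lt); split.
    by apply: in_add_retract aX; exists j, q.
  exists T0, (rcomp f j); split=> //; first exact: pmono_comp (pmono_split qj hX) pf.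
  by move=> [t tP]; apply: nt; exists t => w; have := tP w; rewrite rcompE.
have ii : injm i by apply: injmP => v e; rewrite -[v]pi e hom0.
have [lt|ge] := ltnP (dim V) (dim X); last first.
  have [C [c s]] := ses_mono ii; right=> x; have [_ _ e] := s.
  have C0 : is_zero C by apply: dim_zero; have := dim_ses s; lia.
  by have /e [v <-] : c x = 0 by []; rewrite pi.
have [a aE] := small V i p pi lt.
have sa : surjm (rcomp a f) by move=> v; exists (i v); rewrite rcompE aE.
have [W [j s]] := ses_epi sa.
have [|q [qj jq]] := ses_sect_retr s (s := i); first by move=> v; rewrite rcompE aE.
have [V0|nV] := eqVneq (dim V) 0%N; first by left; apply: dim_zero.
have [|b bE] := small W j q qj; first by have := dim_ses s; lia.
case: ns; exists (radd (rcomp i a) (rcomp j (rcomp b (rsub (rid T0) (rcomp f (rcomp i a)))))).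
move=> x; rewrite !rhE -homB; have := jq x; rewrite !rhE => <-.
by rewrite bE jq rhE addrC subrK.
Qed.

(** Take T' of least dimension with [T] embedding into add T'. If [T] were in add T', a least
    nonsplit [Y] would be a summand of T', say T' = Y (+) Z. Eliminating [Y] from its own embedding
    makes T', hence [T], embed into add [Z], against minimality. *)
Lemma smaller_add_ex X : nonsplit_add X ->
  exists T', [/\ in_add T T', add_embeds o T' T & ~ in_add T' T].
Proof.
move=> nsX.
pose D d := exists T' : rmod A, [/\ dim T' = d, in_add T T' & add_embeds o T' T].
have [d [[T' [dT' aT' eT']] minT']] : exists d, D d /\ forall m, (m < d)%N -> ~ D m.
  apply: nat_least; exists (dim T), T; split=> //; first exact: in_add_refl.
  exists T, (rid T); split; first exact: in_add_refl.
  by apply: pmono_iso => [x y|y]; [rewrite !rhE|exists y; rewrite rhE].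
exists T'; split=> // T'T.
pose E d := exists X : rmod A, dim X = d /\ nonsplit_add X.
have [e [[Y [dY nsY]] minY]] : exists d, E d /\ forall m, (m < d)%N -> ~ E m.
  by apply: nat_least; exists (dim X), X.
have pY : prim Y.
  by apply: (nonsplit_add_prim nsY) => V lt nsV; apply: (minY (dim V)); [lia|exists V].
have [aY [T0 [f [aT0 pf ns]]]] := nsY.
have nY : ~ is_zero Y.
  by move=> Y0; apply: ns; exists (rhom0 _ _) => y; rewrite rhE [RHS]Y0.
have rY := prim_in_add pY nY (in_add_trans T'T aY).
have [Z [phi bphi]] := retract_compl rY.
have [phi' phiK phi'K] := bphi.
have iphi : injm phi by apply: can_inj phiK.
have sphi : surjm phi by move=> y; exists (phi' y).
have rT' : retract T' (dsum Y Z) := retract_iso' iphi sphi.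
have dT : dim T' = (dim Y + dim Z)%N.
  have := dim_ses (ses_id iphi sphi (@rzero_is_zero K A)).
  by rewrite dim_dsum (is_zero_dim (@rzero_is_zero K A)); lia.
have dY0 : dim Y <> 0%N by move/dim_zero.
have aZ : in_add T Z.
  apply: in_add_trans aT' _; apply: in_add_of_retract.
  exact: retract_trans (retract_inr Y Z) (retract_iso iphi sphi).
have hY := fpd_add hT aY; have hZ := fpd_add hT aZ.
have [P [W [aP aW [i [p pi]]]]] := in_add_sum_retract rT' (in_add_trans T'T aT0).
have hPW : fpd o (dsum P W) by apply: fpd_dsum; [exact: fpd_add aP|exact: fpd_add aW].
have ZY : add_embeds o Z Y.
  apply: (@eliminate _ _ o Y Z P W (rcomp i f)) => //.
    exact: pmono_comp pf (pmono_split pi hPW).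
  (* An invertible endomorphism of [Y] factoring through its embedding [f] would yield a retraction
     of [f], so all of them are nilpotent. *)
  move=> h; have [//|[u uE]] := prim_endo (rcomp h (rcomp (rfst P W) (rcomp i f))) pY.
  case: ns; exists (rcomp u (rcomp h (rcomp (rfst P W) i))) => y.
  by rewrite -[RHS]uE !rhE.
have ZZ : add_embeds o Z Z.
  exists Z, (rid Z); split; first exact: in_add_refl.
  by apply: pmono_iso => [x y|y]; [rewrite !rhE|exists y; rewrite rhE].
apply: (minT' (dim Z)); first by lia.
exists Z; split=> //; apply: add_embeds_trans eT'; first exact: fpd_add aT'.
by apply: add_embeds_retract rT' _ (add_embeds_dsum ZY ZZ); apply: fpd_dsum.
Qed.

Lemma lower_tilting X : fpd o X -> ~ ext_pos X T ->
  exists U, [/\ tilting_gen U, fpd o U, ext_pos T U & ~ splits U T].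
Proof.
move=> hX nX; have [TT gT _] := tT.
have [Y /smaller_add_ex [T' [aT' [W [f [aW pf]]] nT']]] := nonsplit_add_ex hX nX.
have [m [g gE]] := left_approx T T'; pose B := power T' m.
have aB : in_add T' B := in_add_power T' m.
have TB : in_add T B := in_add_trans aT' aB.
(* The given embedding of [T] into add T' factors through the approximation [g]; by [pmono_factor],
   [g] is then itself a monomorphism with cokernel in P_n. *)
have [k kE] := left_approx_add gE aW f.
have [C [q [s hC]]] : pmono o g.
  apply: (@pmono_factor _ _ _ _ _ _ _ k); first exact: fpd_add TB.
  by apply: pmono_eq pf => x; rewrite rcompE kE.
have TC : ext_pos T C := ext_pos_right2 s (ext_pos_add2 TT TB) TT.
have CT' : ext_pos C T'.
  case=> [|n]; first by apply: (splits_right0 s); [exact: ext_pos_add1 (ext_pos_add2 TT aT') TB 0%N|].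
  apply: (extz_right s); first exact: ext_pos_add2 TT aT' n.
  exact: ext_pos_add1 (ext_pos_add2 TT aT') TB n.+1.
have CC : ext_pos C C.
  move=> n; apply: (extz_right2 s); first exact: ext_pos_add2 CT' aB n.
  by apply: (extz_right s); [exact: TT|exact: ext_pos_add1 TT TB n.+1].
pose U := dsum T' C.
have TU : ext_pos T U.
  by move=> n; apply: extz_dsum2; [exact: ext_pos_add2 TT aT' n|exact: TC].
have CU : ext_pos C U by move=> n; apply: extz_dsum2; [exact: CT'|exact: CC].
have hU : fpd o U by apply: fpd_dsum => //; exact: fpd_add aT'.
exists U; split=> //; last first.
  move=> sU; have [|r rE] := @splits_ext _ _ C T _ _ g q (rid T) _ s.
    by apply: splits_retract1 sU; apply: retract_inr.
  by apply: nT'; apply: in_add_retract aB; exists g, r => x; rewrite rE rhE.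
split; last by have [d pd] := fpd_pdz hU; exists d.
  by move=> n; apply: extz_dsum1; [exact: ext_pos_add1 TU aT' n|exact: CU].
move=> N UN x.
have CN : ext_pos C N by move=> n; apply: extz_retract1 (retract_inr T' C) (UN n).
have T'N : ext_pos T' N by move=> n; apply: extz_retract1 (retract_inl T' C) (UN n).
(* U^perp lies in T^perp, so [N] is generated by [T]. Maps from [T] to [N] extend along [g] to [B],
   a module in add [U]; hence [U] generates [N] too. *)
have TN : ext_pos T N.
  by move=> n; apply: (extz_left s); [exact: ext_pos_add1 T'N aB n|exact: CN].
have [l [u [y <-]]] := gT N TN x.
have [v [w wE]] := right_approx U N.
have aBU : in_add U B by apply: in_add_trans aB; apply/in_add_of_retract/retract_inl.
have [|t tE] := @right_approx_add _ _ _ _ _ w _ _ (in_add_power T l) u; last first.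
  by exists v, w, (t y); rewrite tE.
move=> h; have [h' h'E] := splits_ext h (CN 0%N) s.
have [t tE] := right_approx_add wE aBU h'.
by exists (rcomp t g) => z; rewrite rcompE tE h'E.
Qed.

End Lowering.

(** * Contravariant finiteness *)

Section Approximations.
Variables (K : fieldType) (A : falgType K) (o : option nat).
Implicit Types (M N P T U V X Y Z W : rmod A).

Definition fpd_perp N : Prop := forall X, fpd o X -> ext_pos X N.

Lemma fpd_perpP N : (forall X, fpd o X -> splits X N) -> fpd_perp N.
Proof.
move=> h X hX n; elim: n X hX => [|n IH] X hX; first exact: h.
have [Y [P [i [p [pP s]]]]] := syzygy_ex X.
apply/(extz_syzygy _ _ pP s)/IH.
exact: fpd_left s (fpd_proj o pP) hX.
Qed.

(* Wakamatsu's lemma: an approximation [p : C -> M] of minimal dimension is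
   right minimal, and then its kernel is orthogonal to the whole class. *)
Lemma wakamatsu M : contravariantly_finite (fpd (A := A) o) ->
  exists (Z C : rmod A) (k : rhom Z C) (p : rhom C M),
    [/\ ses k p, fpd o C & fpd_perp Z].
Proof.
move=> cf; pose D d := exists (C : rmod A) (p : rhom C M), [/\ dim C = d, fpd o C &
  forall X, fpd o X -> forall f : rhom X M, exists g : rhom X C, forall x, p (g x) = f x].
have [d [[C [p [dC hC pC]]] minC]] : exists d, D d /\ forall m, (m < d)%N -> ~ D m.
  by apply: nat_least; have [C [p [hC pC]]] := cf M; exists (dim C), C, p.
(* The Fitting idempotent of [f] is also compatible with [p], so its image is again an approximation
   of [M]; by minimality it is all of [C]. *)
have right_minimal (f : rhom C C) : (forall x, p (f x) = p x) -> injm f.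
  move=> pf; have [V [i [q [g [n [qi fn gf]]]]]] := fitting f.
  have pn x : p (iter n f x) = p x by elim: n {fn} => //= n IH; rewrite pf.
  have piq x : p (i (q x)) = p x by rewrite -pn fn pn.
  have ii : injm i by apply: injmP => v e; rewrite -[v]qi e hom0.
  have [lt|ge] := ltnP (dim V) d.
    case: (minC _ lt); exists V, (rcomp p i); split=> //.
      by apply: fpd_retract hC; exists i, q.
    move=> X hX e; have [h hE] := pC X hX e.
    by exists (rcomp q h) => x; rewrite !rhE piq hE.
  have [Q [c s]] := ses_mono ii.
  have Q0 : is_zero Q by apply: dim_zero; have := dim_ses s; lia.
  apply: injmP => x fx; have [_ _ e] := s; have /e [v vx] : c x = 0 by [].
  by have := gf x; rewrite fx hom0 -vx qi => <-.
have sp : surjm p.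
  move=> x; have [f <-] := regular_generated x.
  have [g gE] := pC _ (fpd_proj o (@projective_regular K A)) f.
  by exists (g (1 : A)); rewrite gE.
have [Z [k s]] := ses_epi sp; exists Z, C, k, p; split=> //.
apply: fpd_perpP => X hX; split=> E i q t.
have [ik _ ep] := s; have [ii sq eq] := t.
(* The pushout [F] is in P_n, and [p] extends to it by zero on [E]. Lifting this map to [C] gives
   [h]; [h i'] is invertible by minimality, and after correction by its inverse [h g] sends [E] into
   the kernel of [p], retracting [E] onto [Z]. *)
have [F [i' [q' [g [t' e1 e2 gen]]]]] := ses_push k t.
have hF := fpd_mid t' hC hX; have [ii' _ _] := t'.
have sF : surjm (rcopair i' g).
  by move=> y; have [c [e ->]] := gen y; exists (c, e); rewrite dsE.
have [|p' p'E] := desc_epi (f := rcopair p (rhom0 E M)) sF.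
  move=> [c e]; rewrite !dsE /= addr0 => ce.
  have /eq [z ze] : q e = 0.
    by have := congr1 q' ce; rewrite homD (ses0 _ t') add0r e2 hom0.
  have : i' (c + k z) = 0 by rewrite homD e1 ze.
  move=> /(injm0 ii')/(congr1 p); rewrite homD (ses0 _ s) addr0 hom0 //.
have [h hE] := pC F hF p'.
have ph c : p (h (i' c)) = p c.
  by rewrite hE; have := p'E (c, 0); rewrite !dsE /= hom0 !addr0.
have pg e : p (h (g e)) = 0.
  by rewrite hE; have := p'E (0, e); rewrite !dsE /= !hom0 !add0r.
have fi : injm (rcomp h i') by apply: right_minimal => c; rewrite rcompE ph.
have [u [u1 u2]] := inv_hom fi (endo_inj_surj fi).
have pu c : p (u c) = p c by rewrite -[in RHS](u2 c) rcompE ph.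
have [e|r rE] := lift_mono (f := rcomp u (rcomp h g)) ik.
  by apply/ep; rewrite !rcompE pu pg.
exists r => z; apply: ik; rewrite rE !rcompE -e1 -[RHS]u1.
by rewrite rcompE.
Qed.

(** The bound [m] matters for n = oo: it is to be found independently of [M]. *)
Definition approximable m M : Prop :=
  exists (Z C : rmod A) (k : rhom Z C) (p : rhom C M),
    [/\ ses k p, fpd o C, pdz m C & fpd_perp Z].

Lemma approximable_leq m n M : (m <= n)%N -> approximable m M -> approximable n M.
Proof.
move=> mn [Z [C [k [p [s hC pC hZ]]]]]; exists Z, C, k, p; split=> //.
exact: pdz_leq mn pC.
Qed.

Lemma approximable_zero m M : is_zero M -> approximable m M.
Proof.
move=> M0; have Z0 := @rzero_is_zero K A.
exists rzero, rzero, (rid _), (rhom0 _ _); split.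
- apply: ses_id M0 => [x y|y]; first by rewrite !rhE.
  by exists y; rewrite rhE.
- exact: fpd_zero.
- by move=> N; apply: extz_zero1.
- by move=> X _ n; apply: extz_zero2.
Qed.

Lemma approximable_iso m M N (f : rhom M N) : injm f -> surjm f ->
  approximable m M -> approximable m N.
Proof.
move=> fi fs [Z [C [k [p [[ik sp e] hC pC hZ]]]]]; exists Z, C, k, (rcomp f p).
split=> //; split=> // [y|c].
  by have [x <-] := fs y; have [c <-] := sp x; exists c; rewrite rcompE.
by rewrite rcompE -e; split=> [/(injm0 fi)//|->]; exact: hom0.
Qed.

(* The extension class in Ext^1(C'', M') lifts along [C' -> M'] because
   Ext^2(C'', Z') vanishes; dually, a map to [Sigma Z'] is extended. *)
Lemma lift_extension (Z' C' M' Y C'' : rmod A) (k : rhom Z' C') (p : rhom C' M')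
    (j : rhom M' Y) (q : rhom Y C'') :
    ses k p -> ses j q -> extz 1 C'' Z' ->
  exists (C : rmod A) (i : rhom Z' C) (r : rhom C Y) (c : rhom C' C) (d : rhom C C''),
    ses i r /\ ses c d.
Proof.
move=> s t e; have [ik sp ep] := s; have [ij sq eq] := t.
have [a aE] := splits_ext (coind_unit Z') (splits_coind M' Z') s.
have [|b bE] := desc_epi (f := rcomp (Sigma_proj Z') a) sp.
  by move=> x /ep [z <-]; rewrite rcompE aE (ses0 _ (Sigma_ses Z')).
have [b' b'E] := splits_ext b e t.
have [C [i [r [g [s' gi gr ex]]]]] := ses_pull b' (Sigma_ses Z').
have [ii sr er] := s'.
have inj : injm (rpair g r).
  apply: injmP => y; rewrite dsE => -[gy /er [z zy]].
  by move: gy; rewrite -zy gi => /(injm0 (@coind_unit_inj _ _ _)) ->; rewrite hom0.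
have [x|c cE] := lift_mono (f := rpair a (rcomp j p)) inj.
  have [|y [y1 y2]] := ex (a x) (j (p x)); first by rewrite b'E bE rcompE.
  by exists y; rewrite !dsE y1 y2.
have gc x : g (c x) = a x by have := cE x; rewrite !dsE => -[].
have rc x : r (c x) = j (p x) by have := cE x; rewrite !dsE => -[].
exists C, i, r, c, (rcomp q r); split=> //; split=> [|z|y].
- apply: injmP => x cx; have /ep [z zx] : p x = 0.
    by apply: (injm0 ij); rewrite -rc cx hom0.
  have : coind_unit Z' z = 0 by rewrite -aE zx -gc cx hom0.
  by move=> /(injm0 (@coind_unit_inj _ _ _)) z0; rewrite -zx z0 hom0.
- by have [y <-] := sq z; have [x <-] := sr y; exists x; rewrite rcompE.
rewrite rcompE; split=> [/eq [m jm]|[x <-]]; last by rewrite rc (ses0 _ t).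
have [x px] := sp m; have /er [z iz] : r (y - c x) = 0.
  by rewrite homB rc px jm subrr.
exists (x + k z); rewrite homD.
have -> : c (k z) = i z.
  by apply: inj; rewrite !dsE gc rc gi aE (ses0 _ s) (ses0 _ s') hom0.
by rewrite iz addrC subrK.
Qed.

(** A horseshoe argument: pull [Y] back to the approximation [C2] of [Z], then lift the resulting
    extension of [C2] by [X] to one by [C1]. The kernel of the composite onto [Y] is an extension of
    the two old kernels. *)
Lemma approximable_ses m X Y Z (i : rhom X Y) (p : rhom Y Z) : ses i p ->
  approximable m X -> approximable m Z -> approximable m Y.
Proof.
move=> s [Z1 [C1 [k1 [p1 [s1 hC1 pC1 hZ1]]]]] [Z2 [C2 [k2 [p2 [s2 hC2 pC2 hZ2]]]]].
have [Y' [i' [p' [k' [q' [t1 t2 _ _ _]]]]]] := ses_pull2 s s2.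
have [C [i3 [r [c [d [u1 u2]]]]]] := lift_extension s1 t1 (hZ1 _ hC2 1%N).
have [G [i4 [p4 [g [v1 v2 _ _]]]]] := ses_noether u1 t2.
exists G, C, g, (rcomp q' r); split=> //.
- exact: fpd_mid u2 hC1 hC2.
- by move=> N; apply: (extz_mid u2); [apply: pC1|apply: pC2].
- by move=> W hW; apply: (ext_pos_mid2 v1); [apply: hZ1|apply: hZ2].
Qed.

Hypothesis cf : contravariantly_finite (fpd (A := A) o).

(** Treating all quotients of [N] at once gives a uniform bound without a list of simple modules. A
    quotient of [N] is an extension of quotients of N' and N''; if [N] is simple, its quotients are
    0 and [N] up to isomorphism. *)
Lemma approximable_quotients N : exists m, forall M (g : rhom N M), surjm g ->
  approximable m M.
Proof.
have [d] := ubnP (dim N); elim: d N => // d IH N; rewrite ltnS => le_d.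
have [[N' [i [ii nz ns]]]|simp] := classic (exists (N' : rmod A) (i : rhom N' N),
    [/\ injm i, ~ is_zero N' & ~ surjm i]).
  have [N'' [q s]] := ses_mono ii; have [_ sq eq] := s; have ds := dim_ses s.
  have d' : dim N' <> 0%N by move/dim_zero.
  have d'' : dim N'' <> 0%N.
    by move/dim_zero => z; apply: ns => y; apply/eq; rewrite [q y]z.
  have [|m' hm'] := IH N'; first by lia.
  have [|m'' hm''] := IH N''; first by lia.
  exists (maxn m' m'') => M g sg.
  have [V [a [b [sa ib ab]]]] := image_fact (rcomp g i).
  have [M'' [c t]] := ses_mono ib; have [_ sc ec] := t.
  have [|e eE] := desc_epi (f := rcomp c g) sq.
    move=> y /eq [x <-]; have := ab x; rewrite !rcompE => <-; exact: ses0 t.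
  apply: (approximable_ses t).
    by apply: approximable_leq (hm' _ a sa); apply: leq_maxl.
  apply: approximable_leq (hm'' _ e _); first exact: leq_maxr.
  move=> z; have [y <-] := sc z; have [x <-] := sg y.
  by exists (q x); rewrite eE rcompE.
have [Z [C [k [p [s hC hZ]]]]] := wakamatsu N cf; have [m pC] := fpd_pdz hC.
exists m => M g sg; have [L [l t]] := ses_epi sg; have [il _ el] := t.
have [L0|nL] := classic (is_zero L).
  apply: (approximable_iso (f := g)) => //; last by exists Z, C, k, p.
  by apply: injmP => x /el [y <-]; rewrite [y]L0 hom0.
apply: approximable_zero => y; have [x <-] := sg y.
have [[z <-]|nx] := classic (exists z, l z = x); first exact: ses0 t.
by case: simp; exists L, l; split=> // sl; apply: nx; apply: sl.
Qed.

Lemma approximable_bound : exists m, forall M, approximable m M.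
Proof.
have [m hm] := approximable_quotients (regular A); exists m => M.
have [d] := ubnP (dim M); elim: d M => // d IH M; rewrite ltnS => le_d.
have [[x nx]|M0] := classic (exists x : M, x <> 0); last first.
  by apply: approximable_zero => x; apply: NNPP => nx; apply: M0; exists x.
have [f fx] := regular_generated x.
have [V [a [b [sa ib ab]]]] := image_fact f.
have [Q [c s]] := ses_mono ib; have ds := dim_ses s.
have dV : dim V <> 0%N.
  by move/dim_zero => V0; apply: nx; rewrite -fx -ab [a _]V0 hom0.
apply: (approximable_ses s); first exact: hm a sa.
by apply: IH; lia.
Qed.

(** A module of P_n is a retract of its own approximation, because the kernel is orthogonal to
    it. *)
Lemma fpd_bound : exists m, forall X, fpd o X -> pdz m X.
Proof.
have [m hm] := approximable_bound; exists m => X hX.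
have [Z [C [k [p [s hC pC hZ]]]]] := hm X.
have [g gE] := splits_sect (hZ X hX 0%N) s.
move=> N; apply: extz_retract1 (pC N); by exists g, p.
Qed.

Lemma fpd_special_preenvelope M : exists (E C : rmod A) (i : rhom M E) (p : rhom E C),
  [/\ ses i p, fpd_perp E & fpd o C].
Proof.
have [Z [C [k [p [s hC hZ]]]]] := wakamatsu (Sigma M) cf.
have [E [i' [p' [k' [q' [s1 s2 _ _ _]]]]]] := ses_pull2 (Sigma_ses M) s.
exists E, C, i', p'; split=> // X hX; apply: (ext_pos_mid2 s2); first exact: hZ.
by move=> n; apply: extz_coind.
Qed.

(** [T] collects the terms of an iterated coresolution of [M] by modules in both P_n and its right
    perpendicular class; each cokernel lowers the degree [n] where Ext is known to vanish. For M = A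
    the factorisation through [T] makes [T] generate T^perp. *)
Lemma fpd_envelope n M : fpd o M -> (forall X, fpd o X -> extz n X M) ->
  exists T, [/\ fpd o T, fpd_perp T & forall N, ext_pos T N -> ext_pos M N /\
    forall f : rhom M N, exists (g : rhom M T) (h : rhom T N), forall x, f x = h (g x)].
Proof.
elim: n M => [|n IH] M hM eM.
  exists M; split=> //; first exact: fpd_perpP.
  by move=> N MN; split=> // f; exists (rid M), f => x; rewrite rhE.
have [E [C [i [p [s pE hC]]]]] := fpd_special_preenvelope M.
have hE := fpd_mid s hM hC.
have [|T [hT pT TP]] := IH C hC.
  by move=> X hX; apply: (extz_right2 s); [exact: pE|exact: eM].
exists (dsum E T); split; [exact: fpd_dsum| |].
  by move=> X hX k; apply: extz_dsum2; [exact: pE|exact: pT].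
move=> N EN.
have CN : ext_pos C N.
  by have [] := TP N => // k; apply: extz_retract1 (retract_inr E T) (EN k).
have EN' : ext_pos E N by move=> k; apply: extz_retract1 (retract_inl E T) (EN k).
split=> [k|f]; first by apply: (extz_left s).
have [g gE] := splits_ext f (CN 0%N) s.
exists (rcomp (rinl E T) i), (rcomp g (rfst E T)) => x.
by rewrite !dsE gE.
Qed.

Lemma contravariantly_finite_tilting :
  exists T, [/\ tilting_gen T, fpd o T & fpd_perp T].
Proof.
have [m hm] := fpd_bound; have pA := @projective_regular K A.
have [||T [hT pT TP]] := @fpd_envelope m (regular A); first exact: fpd_proj.
  by move=> X hX; apply: hm.
exists T; split=> //; split; [exact: pT|move=> N TN x|exact: fpd_pdz hT].
have [f <-] := regular_generated x; have [_ /(_ f) [g [h fE]]] := TP N TN.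
have /in_addP [l [i [p pi]]] := in_add_refl T.
by exists l, (rcomp h p), (i (g (1 : A))); rewrite rcompE pi fE.
Qed.

End Approximations.

Section Equivalence.
Variables (K : fieldType) (A : falgType K) (o : option nat).
Implicit Types (M N T U X : rmod A).

Lemma tiltE T : tilt o T <-> tilting_gen T /\ fpd o T.
Proof. by rewrite /tilt tiltingP PnE. Qed.

Lemma not_lowered_perp T : tilting_gen T -> fpd o T ->
    (forall U, tilting_gen U -> fpd o U -> ext_pos T U -> splits U T) ->
  forall X, fpd o X -> ext_pos X T.
Proof.
move=> tT hT h X hX; apply: NNPP => nX.
by have [U [tU hU TU nU]] := lower_tilting tT hT hX nX; apply: nU; apply: h.
Qed.

Lemma fpd_perp_minimal T : tilting_gen T -> fpd o T -> fpd_perp o T -> tilt_minimal o T.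
Proof.
move=> tT hT pT; split; first exact/tiltE.
move=> U /tiltE [tU hU] /ext_pos_zeroE TU.
have UT := pT U hU.
have [m pU] := fpd_pdz hU; have [l pT'] := fpd_pdz hT.
have aU := perp_closure_in_add tT (ext_pos_perp_closure tT pU UT) TU.
have aT := perp_closure_in_add tU (ext_pos_perp_closure tU pT' TU) UT.
by move=> M; split; apply: in_add_trans.
Qed.

End Equivalence.

Theorem theorem1p2 (K : closedFieldType) (A : falgType K)
    (hbasic : basic_alg A) (hconn : connected_alg A) (n : option nat) :
  [<-> exists T : rmod A, tilt_minimal n T;
       exists T : rmod A, tilt_minimum n T;
       exists T : rmod A, tilt n T /\
         forall M : rmod A, Pn n M -> lperp (in_add T) M;
       exists T : rmod A, tilt n T /\
         forall M : rmod A, lperp (rperp (in_add T)) M <-> Pn n M;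
       contravariantly_finite (@Pn K A n)].
Proof.
tfae.
- move=> [T [/tiltE [tT hT] minT]].
  have TT : ext_pos T T by case: tT.
  have pT := not_lowered_perp tT hT.
  exists T; split=> [|U /tiltE [tU hU]]; first exact/tiltE.
  (* By minimality any tilting [V] below [T] has the same additive closure, so Ext^1(V, T) = 0 and
     [T] cannot be lowered. Then all of P_n, in particular every [U], has no Ext into [T]. *)
  apply/ext_pos_zeroE/pT => // V tV hV TV.
  have eV : add_equiv V T by apply: minT; [exact/tiltE|exact/ext_pos_zeroE].
  exact: ext_pos_add1 TT ((eV V).1 (in_add_refl V)) 0%N.
- move=> [T [/tiltE [tT hT] minT]]; exists T; split; first exact/tiltE.
  move=> M /PnE hM; apply/lperp_addP; apply: (not_lowered_perp tT hT) hM => U tU hU TU.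
  by have /ext_pos_zeroE/(_ 0%N) : tilt_ge U T by apply/minT/tiltE.
- move=> [T [/tiltE [tT hT] pT]]; exists T; split; first exact/tiltE.
  move=> M; rewrite lperp_rperpP; split=> [LM|hM].
    by have [m [pTm _ hm]] := fpd_common hT hT; apply/PnE/hm/(perp_closure_pdz pTm).
  have [m pM] := fpd_pdz ((PnE n M).1 hM).
  by apply: (ext_pos_perp_closure tT pM); apply/lperp_addP/pT.
- move=> [T [/tiltE [tT hT] LP]] M.
  have [Y [X [j [q [s TY LX]]]]] := special_precover tT M.
  exists X, q; split; first by apply/LP/lperp_rperpP.
  move=> Z /LP/lperp_rperpP LZ f.
  exact: splits_lift f (LZ Y TY 0%N) s.
move=> cf; have [|T [tT hT pT]] := @contravariantly_finite_tilting K A n.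
  move=> M; have [C [p [/PnE hC pC]]] := cf M; exists C, p; split=> // X /PnE hX.
  exact: pC.
by exists T; apply: fpd_perp_minimal.
Qed.
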